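(* Let $M$ be a complete $\omega$-homogeneous Urysohn metric space. Then the topological group $\mathrm{Iso}(M)$ is complete, Roelcke-precompact, minimal and topologically simple. Moreover, the weight of $\mathrm{Iso}(M)$ is equal to the weight of $M$.
   Context: For a metric space $M$, $\mathrm{Iso}(M)$ denotes the topological group of all isometries of $M$ onto itself with the topology of pointwise convergence. A metric space $M$ is $\omega$-homogeneous if every isometry (distance-preserving bijection) $f:A\to B$ between finite subsets $A,B$ of $M$ extends to an isometry of $M$ onto itself. A metric space $M$ is Urysohn if its diameter equals $1$ and for every finite metric space $L$ of diameter $\le1$, every $K\subset L$ and every isometric embedding $f:K\to M$, $f$ extends to an isometric embedding of $L$ into $M$. For a topological group $H$, let $\mathcal N(H)$ be the filter of neighbourhoods of the neutral element. $H$ is complete if it is complete with respect to the upper uniformity $\mathcal L\vee\mathcal R$, the least upper bound of the left uniformity $\mathcal L$ (basic entourages $\{(x,y):x^{-1}y\in U\}$, $U\in\mathcal N(H)$) and the right uniformity $\mathcal R$ (basic entourages $\{(x,y):yx^{-1}\in U\}$). $H$ is minimal if it is Hausdorff and admits no strictly coarser Hausdorff group topology. $H$ is Roelcke-precompact if for every $U\in\mathcal N(H)$ there is a finite set $F\subset H$ with $UFU=H$. $H$ is topologically simple if it has no closed normal subgroups besides $H$ and $\{1\}$. The weight of a topological space $X$ is the minimal cardinality of a base for $X$. *)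

(* Defs.v *)
From HB Require Import structures.
From mathcomp Require Import all_boot all_order all_algebra.
From mathcomp Require Import all_classical all_reals all_analysis.

Set Implicit Arguments.
Unset Strict Implicit.
Unset Printing Implicit Defensive.

Import Order.TTheory GRing.Theory Num.Theory.

Local Open Scope group_scope.
Local Open Scope classical_set_scope.
Local Open Scope card_scope.

HB.mixin Record Group_isTopologicalGroup G & Group G & Topological G := {
  mulg_continuous : continuous (fun p : G * G => p.1 * p.2);
  invg_continuous : continuous (fun x : G => x^-1) }.

#[short(type="topologicalGroupType")]
HB.structure Definition TopologicalGroup :=
  {G of Group G & Topological G & Group_isTopologicalGroup G}.

(* The same two axioms for a second topology [t] on the same group; this is
   what is needed to compare different group topologies on [G]. *)
Definition group_topology (G : groupType) (t : Topological G) : Prop :=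
  let T : topologicalType := Topological.Pack t in
  continuous (fun p : T * T => (p.1 : G) * p.2 : T) /\
  continuous (fun x : T => (x : G)^-1 : T).

Definition minimal_group (G : topologicalGroupType) : Prop :=
  hausdorff_space G /\
  forall t : Topological G,
    group_topology t -> hausdorff_space (Topological.Pack t) ->
    @open (Topological.Pack t) `<=` @open G ->
    @open (Topological.Pack t) = @open G.

Definition Roelcke_precompact (G : topologicalGroupType) : Prop :=
  forall U : set G, nbhs 1 U -> exists2 F : set G, finite_set F &
    [set x * y | x in [set u * f | u in U & f in F] & y in U] = setT.

Definition normal_subgroup (G : groupType) (N : set G) : Prop :=
  [/\ N 1, forall x y : G, N x -> N y -> N (x / y) &
      forall x y : G, N x -> N (x ^ y)].

Definition topologically_simple (G : topologicalGroupType) : Prop :=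
  forall N : set G, normal_subgroup N -> closed N ->
    N = setT \/ N = [set 1].

Definition left_entourage (G : topologicalGroupType) : set_system (G * G) :=
  filter_from (nbhs (1 : G)) (fun U => [set p | U (p.1^-1 * p.2)]).

Definition right_entourage (G : topologicalGroupType) : set_system (G * G) :=
  filter_from (nbhs (1 : G)) (fun U => [set p | U (p.2 * p.1^-1)]).

(* The filter generated by the union of two filters consists of the
   intersections of their members. *)
Definition upper_entourage (G : topologicalGroupType) : set_system (G * G) :=
  [set A `&` B | A in @left_entourage G & B in @right_entourage G].

(* An alias of [G], with the same topology, whose canonical uniformity is the
   upper one. *)
Definition upper_uniform (G : topologicalGroupType) : Type := G.

Section upper_uniform.
Variable G : topologicalGroupType.

HB.instance Definition _ := Topological.on (upper_uniform G).

Lemma upper_entourageP (A : set (G * G)) :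
  upper_entourage A <-> exists2 U : set G, nbhs (1 : G) U &
    forall x y : G, U (x^-1 * y) -> U (y * x^-1) -> A (x, y).
Proof.
split=> [[B [U nU UB] [C [V nV VC] <-]]|[U nU UA]].
  exists (U `&` V); first exact: filterI.
  by move=> x y [Uxy _] [_ Vxy]; split; [exact: UB|exact: VC].
exists ([set p | U (p.1^-1 * p.2)] `|` A); first by exists U => // p; left.
exists ([set p | U (p.2 * p.1^-1)] `|` A); first by exists U => // p; left.
apply/seteqP; split=> [[x y] [[Ul|//] [Ur|//]]|p Ap]; first exact: UA.
by split; right.
Qed.

Let upper_filter : Filter (@upper_entourage G).
Proof.
split.
- by apply/upper_entourageP; exists setT => //; exact: filterT.
- move=> A B /upper_entourageP[U nU UA] /upper_entourageP[V nV VB].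
  apply/upper_entourageP; exists (U `&` V); first exact: filterI.
  by move=> x y [? ?] [? ?]; split; [exact: UA|exact: VB].
- move=> A B AB /upper_entourageP[U nU UA].
  by apply/upper_entourageP; exists U => // x y ? ?; exact/AB/UA.
Qed.

Let upper_diagonal (A : set (G * G)) :
  upper_entourage A -> diagonal `<=` A.
Proof.
move=> /upper_entourageP[U nU UA] [x y] /diagonalP ->.
by apply: UA; rewrite ?mulVg ?mulgV; exact: nbhs_singleton.
Qed.

Lemma nbhs1_invg (U : set G) :
  nbhs (1 : G) U -> nbhs (1 : G) [set x | U x^-1].
Proof. by move=> nU; apply: (@invg_continuous G 1); rewrite invg1. Qed.

Lemma nbhs1_mulg (U : set G) : nbhs (1 : G) U ->
  exists2 V, nbhs (1 : G) V & forall x y, V x -> V y -> U (x * y).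
Proof.
move=> nU; have /(_ U)[] := @mulg_continuous G (1, 1).
  by rewrite /= mulg1.
move=> [P Q] /= [nP nQ] PQU; exists (P `&` Q); first exact: filterI.
by move=> x y [Px _] [_ Qy]; exact: (PQU (x, y)).
Qed.

Let upper_inv (A : set (G * G)) : upper_entourage A -> upper_entourage A^-1%relation.
Proof.
move=> /upper_entourageP[U nU UA]; apply/upper_entourageP.
exists [set x | U x^-1]; first exact: nbhs1_invg.
by move=> x y /=; rewrite !invgM !invgK => ? ?; exact: UA.
Qed.

Let upper_split (A : set (G * G)) : upper_entourage A ->
  exists2 B, upper_entourage B & (B \; B)%relation `<=` A.
Proof.
move=> /upper_entourageP[U nU UA]; have [V nV VU] := nbhs1_mulg nU.
exists [set p | V (p.1^-1 * p.2) /\ V (p.2 * p.1^-1)].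
  by apply/upper_entourageP; exists V.
move=> [x y] [z /= [Vxz Vzx] [Vzy Vyz]]; apply: UA.
  by have := VU _ _ Vxz Vzy; rewrite mulgA mulgK.
by have := VU _ _ Vyz Vzx; rewrite mulgA mulgVK.
Qed.

Let upper_nbhs :
  @nbhs _ (upper_uniform G) = nbhs_ (@upper_entourage G).
Proof.
have mulx (x y : G) (W : set G) : nbhs (x * y) W ->
    nbhs y [set z | W (x * z)] /\ nbhs x [set z | W (z * y)].
  move=> nW; have /(_ W nW)[[P Q] /= [nP nQ] PQ] := @mulg_continuous G (x, y).
  split; [apply: filterS nQ => z Qz|apply: filterS nP => z Pz].
    by apply: (PQ (x, z)); split => //; exact: nbhs_singleton.
  by apply: (PQ (z, y)); split => //; exact: nbhs_singleton.
apply/funext => x; apply/seteqP; split=> A.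
  move=> nA; have [nU _] : _ /\ _ := mulx x 1 A ltac:(by rewrite mulg1).
  exists [set p : G * G | A (x * (p.1^-1 * p.2))].
    by apply/upper_entourageP; exists [set z | A (x * z)].
  by move=> y /xsectionP /=; rewrite mulgA mulgV mul1g.
move=> [B /upper_entourageP[U nU UB] BA].
have [nl _] : _ /\ _ := mulx x^-1 x U ltac:(by rewrite mulVg).
have [_ nr] : _ /\ _ := mulx x x^-1 U ltac:(by rewrite mulgV).
apply: filterS (filterI nl nr) => y [/= Uxy Uyx].
by apply/BA/xsectionP/UB.
Qed.

HB.instance Definition _ := Nbhs_isUniform_mixin.Build (upper_uniform G)
  upper_filter upper_diagonal upper_inv upper_split upper_nbhs.

End upper_uniform.

(* The axiom of [completeType], without its requirement of a chosen point. *)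
Definition complete_space (T : uniformType) : Prop :=
  forall F : set_system T, ProperFilter F -> cauchy F ->
    exists x : T, F --> x.

Definition complete_group (G : topologicalGroupType) : Prop :=
  complete_space (upper_uniform G).

Definition minimal_basis (T : topologicalType) (B : set (set T)) : Prop :=
  basis B /\ forall B' : set (set T), basis B' -> B #<= B'.

(* The weight of [T] is the common cardinality of its minimal bases; as the
   library has no type of cardinal numbers, weights are compared through such
   bases. Their existence is part of the assertion. *)
Definition same_weight (S T : topologicalType) : Prop :=
  exists (B : set (set S)) (C : set (set T)),
    [/\ minimal_basis B, minimal_basis C & B #= C].

Section metric_spaces.
Variable R : realType.

(* In [\bar R], so that unbounded spaces are not given diameter [0]; the
   diameter of the empty space is [-oo]. *)
Definition diameter (M : metricType R) : \bar R :=
  ereal_sup [set (mdist p.1 p.2)%:E | p in [set: M * M]].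

Definition isometric_on (X Y : metricType R) (K : set X) (f : X -> Y) : Prop :=
  forall x y, K x -> K y -> mdist (f x) (f y) = mdist x y.

(* [f] only matters on [K]. As a space of diameter [1] is not empty, every map
   from [K] to [M] is the restriction of such an [f]. *)
Definition Urysohn_space (M : metricType R) : Prop :=
  diameter M = 1%:E /\
  forall L : metricType R,
    finite_set [set: L] -> (diameter L <= 1%:E)%E ->
    forall (K : set L) (f : L -> M), isometric_on K f ->
      exists2 g : L -> M, isometric_on setT g & {in K, g =1 f}.

Definition isometry_onto (M : metricType R) (f : M -> M) : Prop :=
  isometric_on setT f /\ set_surj setT setT f.

Definition omega_homogeneous (M : metricType R) : Prop :=
  forall (A B : set M) (f : M -> M), finite_set A -> finite_set B ->
    set_bij A B f -> isometric_on A f ->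
    exists2 g : M -> M, isometry_onto g & {in A, g =1 f}.

End metric_spaces.

Section isometry_group.
Variables (R : realType) (M : metricType R).

Record Iso : Type := MkIso {
  Iso_fun :> M -> M;
  Iso_onto : isometry_onto Iso_fun }.

HB.instance Definition _ := gen_eqMixin Iso.
HB.instance Definition _ := gen_choiceMixin Iso.

Lemma mdist_Iso (f : Iso) x y : mdist (f x) (f y) = mdist x y.
Proof. by case: (Iso_onto f) => + _; exact. Qed.

Lemma eq_Iso (f g : Iso) : f =1 g -> f = g.
Proof.
case: f g => [f Pf] [g Pg] /= /funext fg; case: _ / fg Pg => Pg.
by congr MkIso; exact: Prop_irrelevance.
Qed.

Fact Iso_one_onto : isometry_onto (@idfun M).
Proof. by split=> [//|x _]; exists x. Qed.

Definition Iso_one : Iso := MkIso Iso_one_onto.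

Fact Iso_mul_onto (f g : Iso) : isometry_onto (f \o g).
Proof.
split=> [x y _ _ /=|z _]; first by rewrite !mdist_Iso.
have [_ /(_ z I)[y _ fy]] := Iso_onto f.
by have [_ /(_ y I)[x _ gx]] := Iso_onto g; exists x; rewrite //= gx.
Qed.

Definition Iso_mul (f g : Iso) : Iso := MkIso (Iso_mul_onto f g).

Lemma Iso_preimage (f : Iso) y : exists x, f x = y.
Proof. by have [_ /(_ y I)[x _ fx]] := Iso_onto f; exists x. Qed.

Definition Iso_inv_fun (f : Iso) (y : M) : M := sval (cid (Iso_preimage f y)).

Lemma Iso_invK (f : Iso) : cancel (Iso_inv_fun f) f.
Proof. by move=> y; rewrite /Iso_inv_fun; case: cid. Qed.

Lemma Iso_inj (f : Iso) : injective f.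
Proof.
by move=> x y fxy; apply: mdist_positivity; rewrite -(mdist_Iso f) fxy mdistxx.
Qed.

Fact Iso_inv_onto (f : Iso) : isometry_onto (Iso_inv_fun f).
Proof.
split=> [x y _ _|x _]; first by rewrite -(mdist_Iso f) !Iso_invK.
by exists (f x) => //; apply: (@Iso_inj f); rewrite Iso_invK.
Qed.

Definition Iso_inv (f : Iso) : Iso := MkIso (Iso_inv_onto f).

Fact Iso_mulA : associative Iso_mul. Proof. by move=> f g h; exact: eq_Iso. Qed.
Fact Iso_mul1 : left_id Iso_one Iso_mul. Proof. by move=> f; exact: eq_Iso. Qed.
Fact Iso_mulr1 : right_id Iso_one Iso_mul.
Proof. by move=> f; exact: eq_Iso. Qed.
Fact Iso_mulV : left_inverse Iso_one Iso_inv Iso_mul.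
Proof.
by move=> f; apply: eq_Iso => x /=; apply: (@Iso_inj f); rewrite Iso_invK.
Qed.
Fact Iso_mulrV : right_inverse Iso_one Iso_inv Iso_mul.
Proof. by move=> f; apply: eq_Iso => x /=; rewrite Iso_invK. Qed.

HB.instance Definition _ := isGroup.Build Iso
  Iso_mulA Iso_mul1 Iso_mulr1 Iso_mulV Iso_mulrV.

HB.instance Definition _ := Topological.copy Iso
  (initial_topology (Iso_fun : Iso -> {ptws M -> M})).

Lemma cvg_Iso (F : set_system Iso) (f : Iso) : Filter F ->
  F --> f <-> forall x, h x @[h --> F] --> f x.
Proof.
move=> FF; have FF' : Filter (Iso_fun @ F) by exact: fmap_filter.
split=> [Ff|/(@pointwise_cvgP M M _ f FF') Ff].
  apply/(@pointwise_cvgP M M _ f FF').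
  apply: cvg_trans (@initial_continuous _ _ (Iso_fun : Iso -> {ptws M -> M}) f).
  exact: cvg_app.
move=> A [_ [[B oB <-] Bf BA]].
by apply: (filterS BA); apply: Ff; exact: open_nbhs_nbhs.
Qed.

Lemma cvg_Iso_mdist T (F : set_system T) (u : T -> Iso) (f : Iso) : Filter F ->
  u @ F --> f <->
  forall x (e : R), (0 < e)%R -> \forall t \near F, (mdist (f x) (u t x) < e)%R.
Proof.
move=> FF; rewrite cvg_Iso; split=> uf x.
  by move=> e e0; move/metricType_numDomainType.cvgrPdist_lt : (uf x) => /(_ e e0).
by apply/metricType_numDomainType.cvgrPdist_lt => e e0; exact: uf.
Qed.

Let Iso_mulg_continuous : continuous (fun p : Iso * Iso => p.1 * p.2).
Proof.
move=> [f g]; apply/cvg_Iso_mdist => x e e0.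
have e2 : (0 < e / 2)%R by rewrite divr_gt0.
have /cvg_Iso_mdist/(_ (g x) _ e2) : p.1 @[p --> (f, g)] --> f by exact: cvg_fst.
have /cvg_Iso_mdist/(_ x _ e2) : p.2 @[p --> (f, g)] --> g by exact: cvg_snd.
apply: filterS2 => -[h k] /= gk fh.
rewrite (le_lt_trans (metric_triangle _ (h (g x)) _))// mdist_Iso.
by rewrite [e]splitr ltrD.
Qed.

Let Iso_invg_continuous : continuous (fun f : Iso => f^-1).
Proof.
move=> f; apply/(@cvg_Iso_mdist _ _ _ _ (nbhs_filter f)) => x e e0.
have ff : h @[h --> f] --> f by [].
move/(@cvg_Iso_mdist _ _ _ f (nbhs_filter f)): ff.
move=> /(_ (Iso_inv_fun f x) _ e0); apply: filterS => h /=; rewrite Iso_invK => fh.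
by rewrite -(mdist_Iso h) Iso_invK metric_sym.
Qed.

HB.instance Definition _ := Group_isTopologicalGroup.Build Iso
  Iso_mulg_continuous Iso_invg_continuous.

End isometry_group.

(* Main.v *)
(* Everything rests on one amalgamation fact: if finite families (x_i), (y_i) in
   M satisfy |d(x_i,x_j) - d(y_i,y_j)| <= e_i + e_j, then the function
   r(x,y) = min(1, min_i (d(x,x_i) + e_i + d(y_i,y))) is realised on any finite
   set as d(w x, y) by some isometry w. Adding points one at a time with the
   Urysohn property and then using homogeneity produces w. It follows that
   the matrix (d(a, g a')) over a finite set A determines g up to a small double
   coset (Roelcke precompactness), and that a finite set can be moved into
   independent position over another one.
   For minimality and simplicity, let V be the neighbourhood filter of 1 for a
   coarser, possibly non-Hausdorff, group topology. Suppose that for some x and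
   c > 0 each member of V contains, for every finite A, some g with
   d(x, g a) >= c on A. Multiplying such elements, with independent isometries
   in between, yields elements of V with d(a, g a') = 1 on A. Then g and g h have
   the same matrix for every h, so every h lies in every member of V. If no such
   x and c exist, every ultrafilter containing V is Cauchy pointwise, together
   with its inverse, and completeness of M makes it converge in Iso(M); in the
   Hausdorff case its limit is 1, so the coarser topology is the original one.
   For a nontrivial normal subgroup N, the filter of the sets containing some UN
   is of the first kind, hence N is dense.
   For the weights, the orbit maps are open, and a base C of M yields a base of
   Iso(M) indexed by finite sequences over C x C. *)

Require Import Defs.
From HB Require Import structures.
From mathcomp Require Import all_boot all_order all_algebra.
From mathcomp Require Import all_classical all_reals all_analysis.
From mathcomp Require Import lra.

Set Implicit Arguments.
Unset Strict Implicit.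
Unset Printing Implicit Defensive.

Import Order.TTheory GRing.Theory Num.Theory.

Local Open Scope classical_set_scope.
Local Open Scope ring_scope.

(** * Amalgamation in the Urysohn space *)

Section bounded_metric.
Variables (R : realType) (M : metricType R).
Implicit Types (x y z : M) (s t A : seq M).

(* The alias only exists to carry the metric structure built from [f]. *)
Definition one_point_ext (A : seq M) (f : M -> R)
  (_ : {in A, forall x, 0 < f x})
  (_ : {in A &, forall x y, f x <= f y + mdist x y /\ mdist x y <= f x + f y})
  : Type := option (seq_sub A).

(** * Adding one point to a finite metric space *)

Section one_point_ext_metric.
Variables (A : seq M) (f : M -> R).
Hypothesis f_gt0 : {in A, forall x, 0 < f x}.
Hypothesis f_katetov :
  {in A &, forall x y, f x <= f y + mdist x y /\ mdist x y <= f x + f y}.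
Let L := one_point_ext f_gt0 f_katetov.

HB.instance Definition _ := Choice.copy L (option (seq_sub A)).

(** [None] is the new point, at distance [f a] from each old point [a]. The Katetov condition
    [f_katetov] is the triangle inequality for triangles with one vertex at [None]. *)
Definition one_point_dist (u v : L) : R :=
  match u, v with
  | Some a, Some b => mdist (ssval a) (ssval b)
  | Some a, None | None, Some a => f (ssval a)
  | None, None => 0
  end.

Let one_point_distxx u : one_point_dist u u = 0.
Proof. by case: u => [a|] //=; exact: mdistxx. Qed.

Let one_point_dist_positivity u v : one_point_dist u v = 0 -> u = v.
Proof.
case: u v => [a|] [b|] //= h.
- by congr Some; apply/val_inj/mdist_positivity.
- by have := f_gt0 (ssvalP a); rewrite h ltxx.
- by have := f_gt0 (ssvalP b); rewrite h ltxx.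
Qed.

Let one_point_dist_sym u v : one_point_dist u v = one_point_dist v u.
Proof. by case: u v => [a|] [b|] //=; exact: metric_sym. Qed.

Let one_point_dist_triangle v u w :
  one_point_dist u w <= one_point_dist u v + one_point_dist v w.
Proof.
case: u v w => [a|] [b|] [c|] /=.
- exact: metric_triangle.
- by have [h _] := f_katetov (ssvalP a) (ssvalP b); rewrite addrC.
- by have [_ h] := f_katetov (ssvalP a) (ssvalP c).
- by rewrite addr0.
- by have [h _] := f_katetov (ssvalP c) (ssvalP b); rewrite metric_sym.
- by have h := f_gt0 (ssvalP b); rewrite addr_ge0 // ltW.
- by rewrite add0r.
- by rewrite addr0.
Qed.

HB.instance Definition _ := isMetric.Build R L one_point_distxx
  one_point_dist_positivity one_point_dist_sym one_point_dist_triangle.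

End one_point_ext_metric.

Hypothesis M_Urysohn : Urysohn_space M.

Lemma Urysohn_dist_le1 x y : mdist x y <= 1.
Proof.
have [dM _] := M_Urysohn; rewrite -lee_fin -dM.
by apply: ereal_sup_ubound; exists (x, y).
Qed.

Lemma Urysohn_inhabited : exists x : M, True.
Proof.
apply: contrapT => M0; have [+ _] := M_Urysohn.
rewrite /diameter (_ : setT = set0) ?image_set0 ?ereal_sup0 //.
by rewrite -subset0 => p _; apply: M0; exists p.1.
Qed.

(** The pairs of [P] prescribe the distances from the point sought. A point may be listed several
    times: the second hypothesis, at distance 0, forces its values to agree. *)
Lemma one_point_extension (P : seq (M * R)) :
  {in P, forall p, p.2 <= 1} ->
  {in P &, forall p q, p.2 <= q.2 + mdist p.1 q.1 /\ mdist p.1 q.1 <= p.2 +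
    q.2} ->
  exists y, {in P, forall p, mdist p.1 y = p.2}.
Proof.
move=> P1 PK.
have [x0 _] := Urysohn_inhabited.
(* A prescribed distance 0 forces the answer [p.1]. This case is split off because the metric on the
   extension needs positive values. *)
have [[p pP p0]|Pn0] := pselect (exists2 p, p \in P & p.2 = 0).
  exists p.1 => q qP; have [h _] := PK q p qP pP.
  have [_ h'] := PK q p qP pP; lra.
have P0 p : p \in P -> 0 < p.2.
  move=> pP; have [_] := PK p p pP pP; rewrite mdistxx => p0.
  rewrite lt_neqAle; apply/andP; split; last lra.
  by apply/eqP => p02; apply: Pn0; exists p.
pose A := [seq p.1 | p <- P].
pose f x := (nth (x, 0) P (find (fun p => p.1 == x) P)).2.
have fP x : x \in A -> (x, f x) \in P.
  case/mapP => p pP ->{x}; rewrite /f.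
  have hp : has (fun q => q.1 == p.1) P by apply/hasP; exists p.
  have := nth_find (p.1, 0) hp => /eqP h.
  rewrite -{1}h -surjective_pairing mem_nth // -has_find //.
have f0 : {in A, forall x, 0 < f x} by move=> x /fP/P0.
have fK : {in A &, forall x y, f x <= f y + mdist x y /\ mdist x y <= f x + f
  y}.
  by move=> x y /fP xP /fP yP; exact: PK xP yP.
pose L : metricType R := one_point_ext f0 fK.
have L_fin : finite_set [set: L].
  have -> : [set: L] = [set` finset.setT : {set option (seq_sub A)}].
    by apply/seteqP; split=> x //= _; rewrite finset.in_setT.
  exact: finite_finpred.
have L_diam : (diameter L <= 1%:E)%E.
  apply: ge_ereal_sup => _ [[u v] _ <-]; rewrite lee_fin.
  case: u v => [a|] [b|]; rewrite /mdist/=.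
  - exact: Urysohn_dist_le1.
  - exact: P1 (fP _ (ssvalP a)).
  - exact: P1 (fP _ (ssvalP b)).
  - exact: ler01.
(* The embedding to extend is the inclusion of the old points; [x0] is a dummy value at [None],
   outside its domain. *)
have [|g giso gA] := M_Urysohn.2 L L_fin L_diam [set u | u != None :> option _]
    (fun u => if u is Some a then ssval a else x0).
  by case=> [a|] [b|].
exists (g None) => p pP.
have pA : p.1 \in A by apply/mapP; exists p.
have /(_ _)/= gp := gA (Some (SeqSub pA)).
rewrite -[X in mdist X _]gp; last by rewrite inE.
rewrite giso // /mdist /=.
have [h h'] := PK p (p.1, f p.1) pP (fP _ pA).
have [k k'] := PK (p.1, f p.1) p (fP _ pA) pP.
move: h k; rewrite /= mdistxx; lra.
Qed.

(** Join two copies of [M] by an edge of length [p.2] from [p.1.1] to [p.1.2] for each [p]. This is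
    the least length of a path from [x] to [y] crossing once, cut off at 1. *)
Definition glue_dist (P : seq (M * M * R)) x y : R :=
  \big[Order.min/1]_(p <- P) (mdist x p.1.1 + p.2 + mdist p.1.2 y).

Lemma glue_dist_le P p x y : p \in P ->
  glue_dist P x y <= mdist x p.1.1 + p.2 + mdist p.1.2 y.
Proof. by move=> pP; apply: ge_bigmin_seq. Qed.

Lemma glue_dist_le1 P x y : glue_dist P x y <= 1.
Proof. exact: bigmin_le_id. Qed.

Lemma glue_dist_ge P x y e : e <= 1 ->
  {in P, forall p, e <= mdist x p.1.1 + p.2 + mdist p.1.2 y} ->
  e <= glue_dist P x y.
Proof. by move=> e1 eP; rewrite /glue_dist big_seq; exact: le_bigmin. Qed.


(** * The amalgam of two copies of the space and its realisation *)

Section glue.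
Variable P : seq (M * M * R).
Hypothesis P_distortion : {in P &, forall p q,
  `|mdist p.1.1 q.1.1 - mdist p.1.2 q.1.2| <= p.2 + q.2}.

Lemma glue_distP x y : glue_dist P x y = 1 \/
  exists2 p, p \in P & glue_dist P x y = mdist x p.1.1 + p.2 + mdist p.1.2 y.
Proof.
rewrite /glue_dist big_seq; elim/big_ind: _ => [|u v hu hv|p pP].
- by left.
- by rewrite /Order.min; case: ifP.
- by right; exists p.
Qed.

Let distortion_l p q : p \in P -> q \in P ->
  mdist p.1.1 q.1.1 <= mdist p.1.2 q.1.2 + p.2 + q.2.
Proof.
by move=> pP qP; have := P_distortion pP qP; rewrite ler_distl => /andP[]; lra.
Qed.

Let distortion_r p q : p \in P -> q \in P ->
  mdist p.1.2 q.1.2 <= mdist p.1.1 q.1.1 + p.2 + q.2.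
Proof.
by move=> pP qP; have := P_distortion pP qP; rewrite ler_distl => /andP[]; lra.
Qed.

Let weight_ge0 p : p \in P -> 0 <= p.2.
Proof.
move=> pP; have := P_distortion pP pP; rewrite !mdistxx subr0 normr0; lra.
Qed.

Lemma glue_dist_ge0 x y : 0 <= glue_dist P x y.
Proof.
apply: glue_dist_ge => [|p pP]; first exact: ler01.
by rewrite !addr_ge0 ?mdist_ge0 ?weight_ge0.
Qed.

(** This and the next three inequalities are the mixed triangle inequalities: [mdist] inside the
    copies and [glue_dist] across them form a pseudometric on the disjoint union. *)
Lemma glue_dist_lipl x x' y : glue_dist P x y <= glue_dist P x' y + mdist x x'.
Proof.
case: (glue_distP x' y) => [->|[p pP ->]].
  by rewrite (le_trans (glue_dist_le1 _ _ _)) // lerDl mdist_ge0.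
have := glue_dist_le x y pP; have := metric_triangle x x' p.1.1; lra.
Qed.

Lemma glue_dist_lipr x y y' : glue_dist P x y <= glue_dist P x y' + mdist y y'.
Proof.
case: (glue_distP x y') => [->|[p pP ->]].
  by rewrite (le_trans (glue_dist_le1 _ _ _)) // lerDl mdist_ge0.
have := glue_dist_le x y pP; have := metric_triangle p.1.2 y' y.
rewrite (metric_sym y' y); lra.
Qed.

Lemma glue_dist_trianglel x x' y :
  mdist x x' <= glue_dist P x y + glue_dist P x' y.
Proof.
have gx := glue_dist_ge0 x y; have gx' := glue_dist_ge0 x' y.
have d1 := Urysohn_dist_le1 x x'.
(* A value 1 suffices, as distances are at most 1. Otherwise both minima are attained, at [p] and
   [q], and the distortion bound carries the path through [y] back to the first copy. *)
case: (glue_distP x y) => [->|[p pP E]]; first lra.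
case: (glue_distP x' y) => [->|[q qP E']]; first lra.
rewrite E E'.
have := metric_triangle x p.1.1 x'; have := metric_triangle p.1.1 q.1.1 x'.
have := distortion_l pP qP; have := metric_triangle p.1.2 y q.1.2.
rewrite (metric_sym y) (metric_sym q.1.1); lra.
Qed.

Lemma glue_dist_triangler x y y' :
  mdist y y' <= glue_dist P x y + glue_dist P x y'.
Proof.
have gx := glue_dist_ge0 x y; have gx' := glue_dist_ge0 x y'.
have d1 := Urysohn_dist_le1 y y'.
case: (glue_distP x y) => [->|[p pP E]]; first lra.
case: (glue_distP x y') => [->|[q qP E']]; first lra.
rewrite E E'.
have := metric_triangle y p.1.2 y'; have := metric_triangle p.1.2 q.1.2 y'.
have := distortion_r pP qP; have := metric_triangle p.1.1 x q.1.1.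
rewrite (metric_sym y p.1.2) (metric_sym p.1.1 x); lra.
Qed.

(** The images are placed one at a time: the new one gets the distances [glue_dist] to [t] and
    [mdist x z] to the images [h z] already placed. The mixed triangle inequalities make this
    prescription admissible. *)
Lemma glue_map s t : exists2 h : M -> M, {in s &, forall x y, mdist (h x) (h
  y) = mdist x y}
  & {in s & t, forall x y, mdist (h x) y = glue_dist P x y}.
Proof.
elim: s => [|x s [h hiso hglue]]; first by exists id.
have [xs|xs] := boolP (x \in s).
  exists h => y z; rewrite !inE => /predU1P[->|ys].
  - by move=> /predU1P[->|zs]; exact: hiso.
  - by move=> /predU1P[->|zs]; exact: hiso.
  - exact: hglue.
  - exact: hglue.
have [||y hy] := @one_point_extension
    ([seq (y, glue_dist P x y) | y <- t] ++ [seq (h z, mdist x z) | z <- s]).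
- move=> p; rewrite mem_cat => /orP[] /mapP[z _ ->].
    exact: glue_dist_le1.
  exact: Urysohn_dist_le1.
- move=> p q;
    rewrite !mem_cat => /orP[] /mapP[y yt ->{p}] /orP[] /mapP[z zt ->{q}] /=.
  + by split; [exact: glue_dist_lipr|exact: glue_dist_triangler].
  + rewrite (metric_sym y) hglue //; have := glue_dist_lipl x z y.
    have := glue_dist_lipl z x y; rewrite (metric_sym z x); split; lra.
  + rewrite hglue //; split.
      have := glue_dist_trianglel x y z; lra.
    have := glue_dist_lipl y x z; rewrite (metric_sym y x); lra.
  + rewrite hiso //; have := metric_triangle x z y;
      have := metric_triangle y x z.
    rewrite (metric_sym z y) (metric_sym y x) => h1 h2; split; last lra.
    have := metric_triangle x y z; lra.
exists (fun z => if z == x then y else h z).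
  move=> z z'; rewrite !inE.
  have [->|_] /= := eqVneq z x; have [->|_] /= := eqVneq z' x => //.
  - by rewrite !mdistxx.
  - move=> _ z's; rewrite metric_sym (hy (h z', mdist x z')) // mem_cat.
    by rewrite (map_f (fun z => (h z, mdist x z))) ?orbT.
  - move=> zs _;
      rewrite (hy (h z, mdist x z)) /= ?(metric_sym x) // mem_cat metric_sym.
    by rewrite (map_f (fun z => (h z, mdist x z))) ?orbT.
  - exact: hiso.
move=> z z'; rewrite inE.
have [->|_] /= := eqVneq z x; last exact: hglue.
move=> _ z't; rewrite metric_sym (hy (z', glue_dist P x z')) // mem_cat.
by rewrite (map_f (fun y => (y, glue_dist P x y))).
Qed.

Hypothesis M_homogeneous : omega_homogeneous M.

Lemma glue_isometry s t : exists w : Iso M,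
  {in s & t, forall x y, mdist (w x) y = glue_dist P x y}.
Proof.
have [h hiso hglue] := glue_map s t.
have [||||g gonto gh] := @M_homogeneous [set` s] (h @` [set` s]) h.
- exact: finite_seq.
- exact/finite_image/finite_seq.
- split.
  + by move=> x xs; exists x.
  + move=> x y; rewrite !inE /= => xs ys hxy; apply: mdist_positivity.
    by rewrite -hiso // hxy mdistxx.
  + by move=> _ [x xs <-]; exists x.
- by move=> x y xs ys; exact: hiso.
exists (MkIso gonto) => x y xs yt /=.
by rewrite gh ?hglue // inE.
Qed.

(** The edge [p] is itself a path of length [p.2]. Weight 0 thus forces [w p.1.1 = p.1.2], which is
    how exact values are prescribed below. *)
Lemma glue_isometry_le : exists w : Iso M,
  {in P, forall p, mdist (w p.1.1) p.1.2 <= p.2}.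
Proof.
have [w wP] := glue_isometry [seq p.1.1 | p <- P] [seq p.1.2 | p <- P].
exists w => p pP; rewrite wP; last 2 first.
- exact: (map_f (fun p => p.1.1)).
- exact: (map_f (fun p => p.1.2)).
by rewrite (le_trans (glue_dist_le _ _ pP)) // !mdistxx add0r addr0.
Qed.

End glue.

Hypothesis M_homogeneous : omega_homogeneous M.

(* The free amalgam of [s] and [t] over [B]. *)
Lemma independent_isometry (B s t : seq M) : exists2 w : Iso M,
  {in B, forall z, w z = z} &
  {in s & t, forall x y e, e <= 1 ->
    {in B, forall z, e <= mdist x z + mdist z y} -> e <= mdist (w x) y}.
Proof.
(* Edges of weight 0 identify each [z] of [B] with its copy, so [w] fixes [B] and every other
   distance is that of a path through [B], or 1. *)
pose P : seq (M * M * R) := [seq (z, z, 0) | z <- B].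
have PB p : p \in P -> exists2 z, z \in B & p = (z, z, 0) by move=> /mapP.
have Pd : {in P &, forall p q,
    `|mdist p.1.1 q.1.1 - mdist p.1.2 q.1.2| <= p.2 + q.2}.
  by move=> p q /PB[z _ ->] /PB[z' _ ->] /=; rewrite subrr normr0 addr0.
have [w wP] := glue_isometry Pd M_homogeneous (B ++ s) (B ++ t).
exists w.
  move=> z zB; apply: mdist_positivity; apply/eqP.
  rewrite eq_le mdist_ge0 andbT wP ?mem_cat ?zB //.
  have zP : (z, z, 0) \in P by apply: (map_f (fun z => (z, z, 0))).
  by rewrite (le_trans (glue_dist_le _ _ zP)) // !mdistxx !addr0.
move=> x y xs yt e e1 eB; rewrite wP ?mem_cat ?xs ?yt ?orbT //.
by apply: glue_dist_ge => // p /PB[z zB ->]; rewrite addr0 eB.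
Qed.

End bounded_metric.

(** * Topology and completeness of the isometry group *)

Section Iso_topology.
Variables (R : realType) (M : metricType R).
Implicit Types (f g h : Iso M) (x y : M).

Lemma IsoE f g x : (f * g)%g x = f (g x). Proof. by []. Qed.

Lemma IsoK f x : (f^-1)%g (f x) = x.
Proof. by rewrite -IsoE mulVg. Qed.

Lemma IsoVK f x : f ((f^-1)%g x) = x.
Proof. by rewrite -IsoE mulgV. Qed.

Lemma mdist_IsoV f x y : mdist ((f^-1)%g x) y = mdist x (f y).
Proof. by rewrite -(mdist_Iso f) IsoVK. Qed.

Definition Iso_ball f (A : seq M) (e : R) : set (Iso M) :=
  [set g | {in A, forall x, mdist (f x) (g x) < e}].

Let Iso_ball_filter f : Filter (filter_from [set p : seq M * R | 0 < p.2]
  (fun p => Iso_ball f p.1 p.2)).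
Proof.
apply: filter_from_filter => [|[A e] [B d] /= e0 d0];
  first by exists ([::], 1); exact: ltr01.
exists (A ++ B, Order.min e d) => /= [|g gAB]; first by rewrite lt_min e0 d0.
by split=> x xA; have := gAB x;
  rewrite mem_cat xA ?orbT lt_min => /(_ isT)/andP[].
Qed.

Lemma nbhs_Iso f (U : set (Iso M)) : nbhs f U <->
  exists A, exists2 e, 0 < e & Iso_ball f A e `<=` U.
Proof.
split=> [fU|[A [e e0 AU]]].
  have : filter_from [set p : seq M * R | 0 < p.2]
      (fun p => Iso_ball f p.1 p.2) --> f.
    apply: (cvg_Iso_mdist id f (Iso_ball_filter f)).2 => x e e0;
      exists ([:: x], e) => //=.
    by move=> g /(_ x); rewrite mem_seq1; exact.
  by move=> /(_ U fU)[[A e] e0 AU]; exists A, e.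
apply: filterS AU _.
have ff : id g @[g --> f] --> f by [].
have {ff} ball1 x : nbhs f [set g | mdist (f x) (g x) < e].
  exact: ((cvg_Iso_mdist id f (nbhs_filter f)).1 ff).
elim: A => [|x A IH]; first exact: filterS (@filterT _ _ (nbhs_filter f)).
apply: filterS2 (ball1 x) IH => g gx gA y.
by rewrite inE => /predU1P[->//|]; exact: gA.
Qed.

Lemma nbhs_Iso_ball f (A : seq M) e : 0 < e -> nbhs f (Iso_ball f A e).
Proof. by move=> e0; apply/nbhs_Iso; exists A, e. Qed.

Lemma nbhs1_fix (U : set (Iso M)) : nbhs (1 : Iso M)%g U ->
  exists A : seq M, forall g, {in A, forall x, g x = x} -> U g.
Proof.
move=> /nbhs_Iso[A [e e0 AU]]; exists A => g gA; apply: AU => x xA.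
by rewrite gA // mdistxx.
Qed.

Lemma Iso_hausdorff : hausdorff_space (Iso M).
Proof.
move=> f g fg; apply: eq_Iso => x; apply: mdist_positivity; apply/eqP.
rewrite eq_le mdist_ge0 andbT; apply/ler_addgt0Pl => e e0.
have e2 : 0 < e / 2 by rewrite divr_gt0.
have [h [hf hg]] := fg _ _ (nbhs_Iso_ball f [:: x] e2) (nbhs_Iso_ball g [:: x]
  e2).
have := hf x (mem_head _ _); have := hg x (mem_head _ _).
have := metric_triangle (f x) (h x) (g x); rewrite (metric_sym (g x)); lra.
Qed.

Lemma cauchy_metricP (F : set_system M) : ProperFilter F ->
  (forall e, 0 < e -> exists2 A, F A & forall x y, A x -> A y -> mdist x y <
    e) ->
  cauchy F.
Proof.
move=> FF FC; apply/cauchy_ballP => e e0.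
have [A FA Ae] := FC e e0.
exists (A, A) => //= -[x y] /= [Ax Ay]; rewrite ballEmdist; exact: Ae.
Qed.

Lemma complete_pointwise (F : set_system M) : complete_space M -> ProperFilter
  F ->
  (forall e, 0 < e -> exists2 A, F A & forall x y, A x -> A y -> mdist x y <
    e) ->
  exists x, forall e, 0 < e -> F [set y | mdist x y < e].
Proof.
move=> Mc FF /cauchy_metricP/Mc[x Fx]; exists x => e e0.
exact: ((metricType_numDomainType.fcvgrPdist_lt x).1 Fx).
Qed.

Hypothesis M_complete : complete_space M.

(** A pointwise limit of surjective isometries is isometric but may fail to be onto; the limit [v]
    of the inverses supplies the preimages. *)
Lemma Iso_cauchy_cvg (F : set_system (Iso M)) : ProperFilter F ->
  (forall x e, 0 < e -> exists2 A, F A & forall f g, A f -> A g ->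
     mdist (f x) (g x) < e /\ mdist ((f^-1)%g x) ((g^-1)%g x) < e) ->
  exists f : Iso M, F --> f.
Proof.
move=> FF FC.
have lim_fun x : exists y, forall e, 0 < e -> F [set f | mdist y (f x) < e].
  have FF' : ProperFilter ((fun f => f x) @ F) by exact: fmap_proper_filter.
  apply: complete_pointwise M_complete FF' _ => e e0.
  have [A FA Ae] := FC x e e0.
  exists [set f x | f in A]; first by apply: (@filterS _ F _ A) => // f Af;
    exists f.
  by move=> _ _ [f Af <-] [g Ag <-]; have [] := Ae f g Af Ag.
have lim_inv x : exists y, forall e, 0 < e -> F [set f : Iso M | mdist y
  ((f^-1)%g x) < e].
  have FF' : ProperFilter ((fun f : Iso M => (f^-1)%g x) @ F) by exact:
    fmap_proper_filter.
  apply: complete_pointwise M_complete FF' _ => e e0.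
  have [A FA Ae] := FC x e e0.
  exists ((fun f : Iso M => (f^-1)%g x) @` A);
    first by apply: (@filterS _ F _ A) => // f Af; exists f.
  by move=> _ _ [f Af <-] [g Ag <-]; have [] := Ae f g Af Ag.
have [u uP] := choice lim_fun; have [v vP] := choice lim_inv.
have u_iso : isometric_on setT u.
  move=> x y _ _; apply/eqP/eqP/eqP; rewrite eq_le; apply/andP; split;
    apply/ler_addgt0Pl => e e0; have e2 : 0 < e / 2 by rewrite divr_gt0.
    have [f [/= fx fy]] := filter_ex (filterI (uP x _ e2) (uP y _ e2)).
    have := metric_triangle (u x) (f x) (u y); rewrite -(mdist_Iso f x).
    have := metric_triangle (f x) (f y) (u y);
      rewrite (metric_sym (f y) (u y)); lra.
  have [f [/= fx fy]] := filter_ex (filterI (uP x _ e2) (uP y _ e2)).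
  have := metric_triangle (f x) (u x) (f y); rewrite -(mdist_Iso f x).
  have := metric_triangle (u x) (u y) (f y); rewrite (metric_sym (f x) (u x));
    lra.
have uv y : u (v y) = y.
  apply: mdist_positivity; apply/eqP.
  rewrite eq_le mdist_ge0 andbT; apply/ler_addgt0Pl => e e0.
  have e2 : 0 < e / 2 by rewrite divr_gt0.
  have [f [/= fx fy]] := filter_ex (filterI (uP (v y) _ e2) (vP y _ e2)).
  have := metric_triangle (u (v y)) (f (v y)) y.
  have := mdist_Iso f (v y) ((f^-1)%g y); rewrite IsoVK; lra.
have u_onto : isometry_onto u by split=> // y _; exists (v y).
exists (MkIso u_onto); by apply: (cvg_Iso_mdist id _ _).2 => x e e0; exact: uP.
Qed.

(** Left closeness of [f] and [g] compares [f x] with [g x], right closeness compares the values of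
    the inverses at [x]. Cauchy for the upper uniformity therefore gives both requirements of
    [Iso_cauchy_cvg]. *)
Lemma Iso_complete : complete_group (Iso M).
Proof.
move=> F FF FC; apply: Iso_cauchy_cvg => x e e0.
have [|[A B] /= [FA FB] AB] := FC [set p : Iso M * Iso M | mdist (p.1 x) (p.2
  x) < e /\
     mdist ((p.1^-1)%g x) ((p.2^-1)%g x) < e].
  apply/upper_entourageP.
  exists (Iso_ball 1%g [:: x] e); first exact: nbhs_Iso_ball.
  move=> f g /(_ x (mem_head _ _)) /= fg /(_ x (mem_head _ _)) /= gf.
  by rewrite metric_sym -mdist_IsoV metric_sym; split=> //;
    rewrite metric_sym mdist_IsoV.
exists (A `&` B); first exact: filterI.
by move=> f g [Af _] [_ Bg]; exact: (AB (f, g)).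
Qed.

End Iso_topology.

(** * Roelcke precompactness *)

Section roelcke.
Variables (R : realType) (M : metricType R).
Hypotheses (M_Urysohn : Urysohn_space M) (M_homogeneous : omega_homogeneous M).
Implicit Types (f g h : Iso M) (x y : M).

(** Gluing with weight [e] along [x] to [x] and [g x] to [f x] gives [w] almost fixing [A] and
    almost sending [g x] to [f x]. Then [w^-1] and [f^-1 * w * g] both almost fix [A]. *)
Lemma double_coset (A : seq M) (e : R) f g : 0 <= e ->
  {in A &, forall x y, `|mdist x (f y) - mdist x (g y)| <= e + e} ->
  exists u v : Iso M, [/\ {in A, forall x, mdist x (u x) <= e},
    {in A, forall x, mdist x (v x) <= e} & g = (u * f * v)%g].
Proof.
move=> e0 fg.
pose P := [seq (x, x, e) | x <- A] ++ [seq (g x, f x, e) | x <- A].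
have [|w wP] := @glue_isometry_le _ _ M_Urysohn P _ M_homogeneous.
  move=> p q; rewrite !mem_cat => /orP[] /mapP[x xA ->{p}] /orP[] /mapP[y yA
    ->{q}] /=.
  - by rewrite subrr normr0 addr_ge0.
  - by rewrite distrC; exact: fg.
  - by rewrite distrC (metric_sym (f x)) (metric_sym (g x)); exact: fg.
  - by rewrite !mdist_Iso subrr normr0 addr_ge0.
exists (w^-1)%g, (f^-1 * w * g)%g; split.
- move=> x xA; rewrite metric_sym mdist_IsoV metric_sym.
  by apply: (wP (x, x, e)); rewrite mem_cat map_f.
- move=> x xA; rewrite metric_sym !IsoE mdist_IsoV.
  apply: (wP (g x, f x, e)); rewrite mem_cat; apply/orP; right.
  exact: (map_f (fun x => (g x, f x, e))).
- by rewrite !mulgA mulgK mulVg mul1g.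
Qed.

Lemma Iso_Roelcke_precompact : Roelcke_precompact (Iso M).
Proof.
move=> U /nbhs_Iso[A [e e0 AU]].
have [x0 _] := Urysohn_inhabited M_Urysohn.
pose N := (Num.bound (e / 2)^-1).+1.
have N0 : 0 < N%:R :> R by rewrite ltr0n.
have Ne : 1 < N%:R * (e / 2).
  rewrite -ltr_pdivrMr ?divr_gt0 // mul1r.
  have := @archi_boundP R (e / 2)^-1;
    rewrite invr_ge0 divr_ge0 ?ltW // => /(_ isT).
  by move=> /lt_trans; apply; rewrite ltr_nat.
(* The matrix of [g] over [A], rounded down to multiples of [1 / N], where [1 / N < e / 2]. The
   distance 1 has code [N], hence the [N.+1] values. *)
pose code g : {ffun 'I_(size A) * 'I_(size A) -> 'I_N.+1} :=
  [ffun ij : 'I_(size A) * 'I_(size A) => inord (Num.trunc (N%:R * mdist (nth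
    x0 A ij.1) (g (nth x0 A ij.2))))].
have codeP f g : code f = code g ->
    {in A &, forall x y, `|mdist x (f y) - mdist x (g y)| <= e / 2}.
  move=> fg x y xA yA.
  have xi : (index x A < size A)%N by rewrite index_mem.
  have yi : (index y A < size A)%N by rewrite index_mem.
  have /(congr1 val) := congr1 (fun c : {ffun _ -> _} => c (Ordinal xi,
    Ordinal yi)) fg.
  have trunc_lt (d : R) : d <= 1 -> (Num.trunc (N%:R * d) < N.+1)%N.
    by move=> d1; rewrite ltnS truncn_le_nat (@le_lt_trans _ _ N%:R) ?ltr_nat //
      ger_pMr.
  rewrite !ffunE /= !nth_index // !inordK ?trunc_lt ?Urysohn_dist_le1 //.
  have /truncn_itv : 0 <= N%:R * mdist x (f y) by rewrite mulr_ge0 ?mdist_ge0.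
  have /truncn_itv : 0 <= N%:R * mdist x (g y) by rewrite mulr_ge0 ?mdist_ge0.
  move=> /andP[g1 g2] /andP[f1 f2] E; rewrite E -natr1 in f1 f2.
  rewrite -natr1 in g2.
  rewrite -(ler_pM2l N0) -{1}(gtr0_norm N0) -normrM mulrBr.
  apply: le_trans (ltW Ne); rewrite ler_norml; apply/andP; split; lra.
(* One isometry for each code, with 1 as a dummy for codes that do not occur. *)
pose rep c := xget 1%g (code @^-1` [set c]).
exists [set rep c | c in [set: {ffun 'I_(size A) * 'I_(size A) -> 'I_N.+1}]].
  exact/finite_image/finite_finset.
apply/seteqP; split=> // g _.
have fg : code (rep (code g)) = code g by apply: (@xgetPex _ 1%g (code @^-1`
  [set code g])); exists g.
have [||u [v [uA vA ->]]] := @double_coset A (e / 2) (rep (code g)) g.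
- by rewrite divr_ge0 // ltW.
- move=> x y xA yA; rewrite (le_trans (codeP _ _ fg x y xA yA)) // lerDl.
  by rewrite divr_ge0 // ltW.
have e2 : e / 2 < e by lra.
exists (u * rep (code g))%g.
  by exists u; [apply: AU => x /uA/le_lt_trans;
    exact|exists (rep (code g)) => //; exists (code g)].
by exists v => //; apply: AU => x /vA/le_lt_trans; exact.
Qed.

End roelcke.

(** * Spreading elements close to the identity *)

Section spread.
Variables (R : realType) (M : metricType R).
Hypotheses (M_Urysohn : Urysohn_space M) (M_homogeneous : omega_homogeneous M).
Implicit Types (f g h : Iso M) (x y z : M) (r : M -> M -> R).

Lemma Iso_transitive x y : exists f : Iso M, f x = y.
Proof.
have [|f fP] := @glue_isometry_le _ _ M_Urysohn [:: (x, y, 0)] _ M_homogeneous.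
  move=> p q; rewrite !mem_seq1 => /eqP-> /eqP-> /=.
  by rewrite !mdistxx subrr normr0 addr0.
exists f; apply: mdist_positivity; apply/eqP; rewrite eq_le mdist_ge0 andbT.
exact: (fP (x, y, 0) (mem_head _ _)).
Qed.

Variable V : set_system (Iso M).
Hypothesis V_nbhs : forall U, V U -> nbhs (1 : Iso M)%g U.
Hypothesis V_conj : forall U h, V U -> V [set g | U (g ^ h)%g].
Hypothesis V_cube : forall U, V U -> exists W, [/\ V W,
  forall g, W g -> W (g^-1)%g &
  forall f g h, W f -> W g -> W h -> U (f * g * h)%g].

(* By compactness, [spread r] says that the closure of [1] for [V] in the
   Roelcke compactification of [Iso M] contains a function bounded below by
   [r]. *)
Definition spread r := forall U, V U -> forall A : seq M,
  exists2 g, U g & {in A &, forall x y, r x y <= mdist x (g y)}.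

(** Here [k = g * w * h], where [w] fixes [B], hence lies in [W], and puts [h A] in independent
    position from [g^-1 A] over [B]. *)
Lemma independent_product U : V U -> exists W (B : seq M), [/\ V W,
  forall g, W g -> W (g^-1)%g &
  forall g h (A : seq M), W g -> W h -> exists2 k, U k &
    {in A &, forall x y e, e <= 1 ->
      {in B, forall z, e <= mdist x (g z) + mdist z (h y)} ->
      e <= mdist x (k y)}].
Proof.
move=> /V_cube[W [VW WV WU]]; have [B BW] := nbhs1_fix (V_nbhs VW).
exists W, B; split=> // g h A Wg Wh.
have [w wB wP] := independent_isometry M_Urysohn M_homogeneous B (map h A)
  (map (g^-1)%g A).
exists (g * w * h)%g; first by apply: WU => //; exact: BW.
move=> x y xA yA e e1 eB; rewrite !IsoE -mdist_IsoV metric_sym.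
apply: wP => //; rewrite ?map_f // => z zB.
by rewrite (metric_sym z) mdist_IsoV addrC (metric_sym _ z) eB.
Qed.

Lemma spread_mul r s e : (forall x y, e x y <= 1) ->
  (forall x y z, e x y <= r x z + s z y) -> spread r -> spread s -> spread e.
Proof.
move=> e1 ers rs ss U /independent_product[W [B [VW _ WU]]] A.
have [g Wg gAB] := rs W VW (A ++ B); have [h Wh hAB] := ss W VW (A ++ B).
have [k Uk kA] := WU g h A Wg Wh; exists k => // x y xA yA.
apply: kA => // z zB; apply: le_trans (ers x y z) _.
by rewrite lerD ?gAB ?hAB // mem_cat ?xA ?yA ?zB ?orbT.
Qed.

(** Since [s] dominates [mdist], the triangle inequality at [g z] bounds [mdist x (g y)] by
    [mdist x (g z) + mdist z (h y)]. So the product of [g] and [h] spreads at least as much as [g],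
    and symmetrically as much as [h]. *)
Lemma spread_join r s :
  (forall x y, mdist x y <= r x y) -> (forall x y, mdist x y <= s x y) ->
  spread r -> spread s -> spread (fun x y => Num.max (r x y) (s x y)).
Proof.
move=> dr ds rs ss U /independent_product[W [B [VW _ WU]]] A.
have [g Wg gAB] := rs W VW (A ++ B); have [h Wh hAB] := ss W VW (A ++ B).
have [k Uk kA] := WU g h A Wg Wh; exists k => // x y xA yA.
have inAB z : z \in A -> z \in A ++ B by rewrite mem_cat => ->.
have inBA z : z \in B -> z \in A ++ B by rewrite mem_cat orbC => ->.
rewrite ge_max; apply/andP; split.
  apply: le_trans (gAB _ _ (inAB _ xA) (inAB _ yA)) _.
  apply: kA => // [|z zB]; first exact: Urysohn_dist_le1.
  apply: le_trans (metric_triangle _ (g z) _) _; rewrite lerD2l mdist_Iso.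
  by apply: le_trans (ds _ _) _; apply: hAB; [exact: inBA|exact: inAB].
apply: le_trans (hAB _ _ (inAB _ xA) (inAB _ yA)) _.
apply: kA => // [|z zB]; first exact: Urysohn_dist_le1.
apply: le_trans (metric_triangle _ z _) _; rewrite lerD2r.
by apply: le_trans (dr _ _) _; apply: gAB; [exact: inAB|exact: inBA].
Qed.

Lemma spread_mdist : spread (@mdist R M).
Proof. by move=> U /V_nbhs/nbhs_singleton U1 A; exists 1%g. Qed.

Variables (x0 : M) (c : R).
Hypothesis c_gt0 : 0 < c.
Hypothesis V_far : forall U, V U -> forall A : seq M,
  exists2 g, U g & {in A, forall y, c <= mdist x0 (g y)}.

Lemma far_point x U (A : seq M) : V U ->
  exists2 g, U g & {in A, forall y, c <= mdist x (g y)}.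
Proof.
move=> VU; have [f fx] := Iso_transitive x0 x.
have [g Ug gA] := V_far (V_conj (f^-1)%g VU) (map (f^-1)%g A).
exists (g ^ f^-1)%g => // y yA; rewrite conjgE invgK !IsoE -fx mdist_Iso.
by apply: gA; rewrite map_f.
Qed.

Lemma far_le1 : V !=set0 -> c <= 1.
Proof.
move=> [U VU]; have [g _ gA] := far_point x0 [:: x0] VU.
by apply: le_trans (gA x0 (mem_head _ _)) _; exact: Urysohn_dist_le1.
Qed.

(** The matrix of the identity with the diagonal entries over [E] raised to [c]; spreading it means
    moving each point of [E] by at least [c]. *)
Definition diag_dist (E : seq M) x y : R :=
  if (x == y) && (x \in E) then c else mdist x y.

Lemma mdist_le_diag E x y : mdist x y <= diag_dist E x y.
Proof. by rewrite /diag_dist; case: eqVneq => [->|//]; case: ifP => //;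
  rewrite mdistxx ltW. Qed.

(** The independent product of [g] and [g^-1] is used, with [g] keeping [B] at distance at least [c]
    from [x]. Other entries follow from the triangle inequality at [g u]. *)
Lemma spread_diag1 x : spread (diag_dist [:: x]).
Proof.
move=> U /independent_product[W [B [VW WV WU]]] A.
have [g Wg gAB] := far_point x (A ++ B) VW.
have [k Uk kA] := WU g (g^-1)%g A Wg (WV _ Wg); exists k => // y z yA zA.
apply: kA => // [|u uB].
  rewrite /diag_dist; case: ifP => _; last exact: Urysohn_dist_le1.
  by apply: far_le1; exists W.
rewrite (metric_sym u) mdist_IsoV (metric_sym z).
rewrite /diag_dist inE; have [<-|_] := eqVneq y z; last exact: metric_triangle.
case: eqVneq => [->|_] /=; last by rewrite mdistxx addr_ge0 ?mdist_ge0.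
by rewrite -[c]addr0 lerD ?mdist_ge0 // gAB // mem_cat uB orbT.
Qed.

Lemma spread_diag E : spread (diag_dist E).
Proof.
elim: E => [|x E IH].
  move=> U VU A; have [g Ug gA] := spread_mdist VU A; exists g => // y z yA zA.
  by rewrite /diag_dist in_nil andbF gA.
have := spread_join (mdist_le_diag [:: x]) (mdist_le_diag E) (spread_diag1 x)
  IH.
move=> sj U VU A; have [g Ug gA] := sj U VU A; exists g => // y z yA zA.
apply: le_trans (gA _ _ yA zA); rewrite /diag_dist !inE.
case: eqVneq => [<-|_] /=; last by rewrite maxxx.
by case: eqVneq => _ /=; case: ifP => _; rewrite le_max lexx ?orbT.
Qed.

(** With [E = A]: [c <= mdist x (g x) <= mdist x (g y) + mdist x y], and the last term is again at
    most [mdist x (g y)]. *)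
Lemma spread_cst_half : spread (fun _ _ => c / 2).
Proof.
move=> U VU A; have [g Ug gA] := spread_diag A VU A; exists g => // x y xA yA.
have := gA x x xA xA; rewrite /diag_dist eqxx xA /=.
have := gA x y xA yA; have := mdist_le_diag A x y.
have := metric_triangle x (g y) (g x); rewrite mdist_Iso (metric_sym y); lra.
Qed.

(** Each further independent product adds [c / 2] to the lower bound, until the cutoff 1 is
    reached. *)
Lemma spread_cst1 : spread (fun _ _ => 1).
Proof.
have spreadn n : spread (fun _ _ => Num.min (n.+1%:R * (c / 2)) 1).
  elim: n => [|n IH].
    move=> U VU A; have [g Ug gA] := spread_cst_half VU A;
      exists g => // x y xA yA.
    by rewrite mul1r ge_min gA.
  apply: spread_mul IH spread_cst_half => [x y|x y _];
    first by rewrite ge_min lexx orbT.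
  rewrite addr_minl -[n.+2%:R]natr1 mulrDl mul1r le_min ge_min lexx /=.
  by rewrite ge_min lerDl; apply/orP; right; rewrite divr_ge0 ?ltW.
have := @archi_boundP R (c / 2)^-1;
  rewrite invr_ge0 divr_ge0 ?ltW // => /(_ isT).
move: (Num.bound _) => n cn U VU A.
have [g Ug gA] := spreadn n U VU A; exists g => // x y xA yA.
apply: le_trans (gA _ _ xA yA); rewrite le_min lexx andbT.
rewrite -ler_pdivrMr ?divr_gt0 // mul1r (le_trans (ltW cn)) // ler_nat.
exact: leqnSn.
Qed.

(** When all distances from [B] to [g B] and [g h B] are 1, some [w] fixes [B] and sends [g (h x)]
    to [g x] for [x] in [B]. Then [v = g^-1 * w * g * h] fixes [B] as well, so
    [h = g^-1 * w^-1 * g * v] is a word in [W]. *)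
Lemma spread_setT U : V U -> U = setT.
Proof.
move=> /V_cube[W1 [/V_cube[W [VW WV WW1]] W1V W1U]].
have [B BW] := nbhs1_fix (V_nbhs VW).
have W1W g : W g -> W1 g.
  by move=> Wg; rewrite -[g]mulg1 -[g]mulg1; apply: WW1 => //; exact: BW.
apply/seteqP; split=> // h _.
have [g Wg gP] := spread_cst1 VW (B ++ map h B).
pose P : seq (M * M * R) := [seq (x, x, 0) | x <- B] ++ [seq (g (h x), g x, 0)
  | x <- B].
have far x y : x \in B -> y \in B -> mdist x (g (h y)) = mdist x (g y).
  move=> xB yB; have e1 z : z \in B ++ map h B -> mdist x (g z) = 1.
    move=> zB; apply/eqP; rewrite eq_le Urysohn_dist_le1 //=.
    by rewrite gP // mem_cat xB.
  by rewrite !e1 // mem_cat ?yB // map_f ?orbT.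
have [|w wP] := @glue_isometry_le _ _ M_Urysohn P _ M_homogeneous.
  move=> p q; rewrite !mem_cat => /orP[] /mapP[x xB ->{p}] /orP[] /mapP[y yB
    ->{q}] /=.
  - by rewrite subrr normr0 addr0.
  - by rewrite far // subrr normr0 addr0.
  - by rewrite !(metric_sym _ y) far // subrr normr0 addr0.
  - by rewrite !mdist_Iso subrr normr0 addr0.
have wE x y : (x, y, 0) \in P -> w x = y.
  move=> /wP/= wxy; apply: mdist_positivity; apply/eqP.
  by rewrite eq_le wxy mdist_ge0.
have Ww : W w.
  by apply: BW => x xB; apply: wE; rewrite mem_cat (map_f (fun x => (x, x, 0))).
pose v := (g^-1 * w * g * h)%g.
have Wv : W v.
  apply: BW => x xB; rewrite !IsoE (wE (g (h x)) (g x)) ?IsoK //.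
  by rewrite mem_cat orbC (map_f (fun x => (g (h x), g x, 0))).
have -> : h = (g^-1 * w^-1 * g * v * 1)%g.
  by rewrite mulg1 !mulgA mulgK mulgVK mulVg mul1g.
by apply: W1U; [apply: WW1 => //; exact: WV|exact: W1W|apply/W1W/BW].
Qed.

End spread.

(** * Simplicity and minimality *)

Section simple_and_minimal.
Variables (R : realType) (M : metricType R).
Hypotheses (M_Urysohn : Urysohn_space M) (M_homogeneous : omega_homogeneous M).
Implicit Types (f g h : Iso M) (x y z : M).

Lemma nbhs1_conjg (U : set (Iso M)) h : nbhs (1 : Iso M)%g U ->
  nbhs (1 : Iso M)%g [set g | U (g ^ h)%g].
Proof.
move=> /nbhs_Iso[A [e e0 AU]]; apply/nbhs_Iso; exists (map h A), e => // g gA.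
apply: AU => x xA; rewrite conjgE !IsoE metric_sym mdist_IsoV metric_sym.
by apply: gA; rewrite map_f.
Qed.

Lemma Iso_topologically_simple : topologically_simple (Iso M).
Proof.
move=> N [N1 NB NJ] Ncl.
have [[g Ng g1]|Ntriv] := pselect (exists2 g, N g & g <> 1%g); last first.
  right; apply/seteqP; split=> [g Ng|_ ->] //=.
  by apply: contrapT => g1; apply: Ntriv; exists g.
left.
have NV n : N n -> N (n^-1)%g by move=> Nn; rewrite -[(n^-1)%g]mul1g; exact: NB.
have NM m n : N m -> N n -> N (m * n)%g.
  by move=> Nm Nn; rewrite -[n]invgK; apply: NB => //; exact: NV.
have [x gx] : exists x, g x <> x.
  apply: contrapT => gid; apply: g1; apply: eq_Iso => x.
  by apply: contrapT => gx; apply: gid; exists x.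
(* The identity neighbourhoods of the group topology pulled back from the quotient by [N]. *)
pose V : set_system (Iso M) := [set U | exists2 W, nbhs (1 : Iso M)%g W &
  forall u n, W u -> N n -> U (u * n)%g].
have VU U : V U -> U = setT.
  apply: (@spread_setT _ _ M_Urysohn M_homogeneous V _ _ _ x (mdist (g x) x)).
  - move=> {}U [W nW WU]; apply: filterS nW => u Wu.
    by rewrite -[u]mulg1; exact: WU.
  - move=> {}U h [W nW WU]; exists [set u | W (u ^ h)%g];
      first exact: nbhs1_conjg.
    by move=> u n Wu Nn /=; rewrite conjMg; apply: WU => //; exact: NJ.
  - move=> {}U [W0 nW0 WU].
    have [W1 nW1 W10] := nbhs1_mulg nW0; have [W2 nW2 W21] := nbhs1_mulg nW1.
    pose W := W2 `&` [set u | W2 (u^-1)%g].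
    exists [set a | exists u n, [/\ W u, N n & a = (u * n)%g]]; split.
    + exists W; first by apply: filterI => //; exact: nbhs1_invg.
      by move=> u n Wu Nn; exists u, n.
    + move=> _ [u [n [[Wu Wu'] Nn ->]]]; exists (u^-1)%g, ((n^-1) ^ (u^-1))%g.
      split; [by split=> //=; rewrite invgK|exact/NJ/NV|].
      by rewrite invgM conjgE invgK !mulgA mulVg mul1g.
    + move=> _ _ _ [u1 [n1 [[Wu1 _] Nn1 ->]]] [u2 [n2 [[Wu2 _] Nn2 ->]]]
        [u3 [n3 [[Wu3 _] Nn3 ->]]].
      have -> : (u1 * n1 * (u2 * n2) * (u3 * n3) =
          u1 * u2 * u3 * ((n1 ^ u2 * n2) ^ u3 * n3))%g.
        by rewrite !conjgE !mulgA !mulgK.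
      apply: WU; last by apply: (NM) => //; apply: (NJ); apply: (NM) => //;
        exact: NJ.
      apply: W10; first exact: W21.
      by rewrite -[u3]mulg1; apply: W21 => //; exact: nbhs_singleton.
  - by rewrite mdist_gt0; apply/eqP.
  - move=> {}U [W nW WU] A.
    (* Conjugating [g] by a [w] that fixes [x] gives an element of [N] sending [x] to [w (g x)],
       which independence keeps at distance at least [mdist (g x) x] from [A]. The inverse of this
       conjugate is the witness. *)
    have [w wx wP] := independent_isometry M_Urysohn M_homogeneous [:: x] [::
      g x] A.
    exists ((g^-1) ^ w^-1)%g.
      rewrite -[X in U X]mul1g; apply: WU; first exact: nbhs_singleton.
      exact/NJ/NV.
    move=> y yA; rewrite conjgE invgK !IsoE.
    rewrite -mdist_IsoV -mdist_IsoV invgK -mdist_IsoV invgK.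
    have wVx : (w^-1)%g x = x by rewrite -{1}(wx x (mem_head _ _)) IsoK.
    rewrite wVx.
    apply: wP; rewrite ?mem_head ?Urysohn_dist_le1 // => z.
    by rewrite mem_seq1 => /eqP->; rewrite lerDl mdist_ge0.
(* Density of [N]: writing [h^-1 = u * n] with [u] near 1, the element [h * u = n^-1] of [N] is near
   [h]. *)
apply/seteqP; split=> // h _; apply: Ncl => B /nbhs_Iso[A [e e0 AB]].
pose W := Iso_ball (1%g : Iso M) A e.
have : [set a | exists u n, [/\ W u, N n & a = (u * n)%g]] (h^-1)%g.
  rewrite (VU [set a | _]) //; exists W; first exact: nbhs_Iso_ball.
  by move=> u n Wu Nn; exists u, n.
move=> [u [n [Wu Nn hun]]]; exists (h * u)%g; split.
  have -> : (h * u = n^-1)%g; last exact: NV.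
  by rewrite -[h]invgK hun invgM mulgVK.
by apply: AB => y yA; rewrite IsoE mdist_Iso; exact: Wu.
Qed.

Lemma ultra_seq_pigeonhole (T : Type) (I : eqType) (F : set_system T)
    (s : seq I) (P : I -> set T) : UltraFilter F ->
  F [set t | exists2 i, i \in s & P i t] -> exists2 i, i \in s & F (P i).
Proof.
move=> FU; elim: s => [|i s IH] Fs.
  by have [t [j]] := filter_ex Fs.
have [Fi|Fi] := in_ultra_setVsetC (P i) FU; first by exists i;
  rewrite ?mem_head.
have [|j js Fj] := IH; last by exists j => //; rewrite inE js orbT.
apply: filterS (filterI Fs Fi) => t [[j]];
  rewrite inE => /predU1P[->//|js Pj _].
by exists j.
Qed.

Hypothesis M_complete : complete_space M.

(** * Comparison with a coarser Hausdorff group topology *)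

Section coarser_topology.
Variable t : Topological (Iso M).
Hypotheses (t_group : group_topology t)
  (t_hausdorff : hausdorff_space (Topological.Pack t))
  (t_coarser : @open (Topological.Pack t) `<=` @open (Iso M)).

Let tnbhs : Iso M -> set_system (Iso M) := @nbhs _ (Topological.Pack t).

Local Instance tnbhs_filter g : ProperFilter (tnbhs g).
Proof. exact: (@nbhs_pfilter (Topological.Pack t)). Qed.

Let tnbhs_nbhs g U : tnbhs g U -> nbhs g U.
Proof.
rewrite /tnbhs nbhsE => -[B [oB Bg] BU].
by apply: filterS BU _; apply: open_nbhs_nbhs; split=> //; exact: t_coarser.
Qed.

Let tnbhs_mul f g U : tnbhs (f * g)%g U -> exists P Q,
  [/\ tnbhs f P, tnbhs g Q & forall a b, P a -> Q b -> U (a * b)%g].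
Proof.
move=> nU; have [[P Q] /= [nP nQ] PQU] := t_group.1 (f, g) U nU.
by exists P, Q; split=> // a b Pa Qb; exact: (PQU (a, b)).
Qed.

Let tnbhs_inv g U : tnbhs (g^-1)%g U -> tnbhs g [set a | U (a^-1)%g].
Proof. exact: (t_group.2 g U). Qed.

Let tnbhs_mull f g U : tnbhs (f * g)%g U -> tnbhs g [set a | U (f * a)%g].
Proof.
move=> /tnbhs_mul[P [Q [nP nQ PQ]]];
  apply: (@filterS _ (tnbhs g) _ _ _ _ nQ) => a Qa; apply: PQ => //.
exact: (@nbhs_singleton (Topological.Pack t) _ P).
Qed.

Let tnbhs_mulr f g U : tnbhs (f * g)%g U -> tnbhs f [set a | U (a * g)%g].
Proof.
move=> /tnbhs_mul[P [Q [nP nQ PQ]]];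
  apply: (@filterS _ (tnbhs f) _ _ _ _ nP) => a Pa; apply: PQ => //.
exact: (@nbhs_singleton (Topological.Pack t) _ Q).
Qed.

Let V := tnbhs 1%g.

Local Instance tnbhs1_filter : ProperFilter V := tnbhs_filter 1%g.

Let V_conj U h : V U -> V [set g | U (g ^ h)%g].
Proof.
move=> VU; apply: (@tnbhs_mulr 1%g h [set g | U (h^-1 * g)%g]).
by apply: tnbhs_mull; rewrite mul1g mulVg.
Qed.

Let V_cube U : V U -> exists W, [/\ V W,
  forall g, W g -> W (g^-1)%g &
  forall f g h, W f -> W g -> W h -> U (f * g * h)%g].
Proof.
move=> VU; have : tnbhs (1 * 1 * 1)%g U by rewrite !mulg1.
move=> /tnbhs_mul[P [Q [/tnbhs_mul[P1 [P2 [nP1 nP2 PP]]] nQ PQ]]].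
have nW : V (P1 `&` P2 `&` Q) by apply: (@filterI _ V) => //;
  exact: (@filterI _ V).
exists ((P1 `&` P2 `&` Q) `&` [set a | (P1 `&` P2 `&` Q) (a^-1)%g]); split.
- by apply: (@filterI _ V) => //; apply: (@tnbhs_inv 1%g (P1 `&` P2 `&` Q));
    rewrite invg1.
- by move=> g [? ?]; split=> //=; rewrite invgK.
- by move=> f g h [[[? _] _] _] [[[_ ?] _] _] [[_ ?] _]; apply: PQ => //;
    exact: PP.
Qed.

(** Otherwise [spread_setT] makes the topology [t] indiscrete, hence the group trivial by
    separation, although some [g] moves [x] by at least [c]. *)
Let V_not_far x c : 0 < c -> exists2 U, V U & exists A : seq M,
  forall g, U g -> exists2 y, y \in A & mdist x (g y) < c.
Proof.
move=> c0; apply: contrapT => far.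
have V_far U : V U -> forall A : seq M,
    exists2 g, U g & {in A, forall y, c <= mdist x (g y)}.
  move=> VU A; apply: contrapT => nfar; apply: far; exists U => //;
    exists A => g Ug.
  apply: contrapT => gA; apply: nfar; exists g => // y yA.
  by rewrite leNgt; apply/negP => xgy; apply: gA; exists y.
have VT U : V U -> U = setT.
  apply: (@spread_setT _ _ M_Urysohn M_homogeneous V _ V_conj V_cube x c c0
    V_far).
  by move=> {}U; exact: tnbhs_nbhs.
have [g _ gx] := V_far setT (@filterT _ V _) [:: x].
have : 1%g = g.
  apply: t_hausdorff => A B nA nB; exists 1%g; split.
    by rewrite (VT _ nA).
  have : V [set a | B (g * a)%g] by apply: tnbhs_mull; rewrite mulg1.
  by move=> /VT BT; have : setT (g^-1)%g by []; rewrite -BT /= mulgV.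
move=> g1; have := gx x (mem_head _ _).
by rewrite -g1 mdistxx leNgt c0.
Qed.

(** By [V_not_far], [x] is close to [g A] for [F]-many [g]. The ultrafilter selects a single [y] in
    [A], so [g^-1 x] stays near [y]; symmetry of [V] handles [g x]. *)
Let ultra_cvg (F : set_system (Iso M)) : UltraFilter F -> V `<=` F ->
  exists f : Iso M, F --> f.
Proof.
move=> FU VF; apply: (Iso_cauchy_cvg M_complete) => x e e0.
have [|U VU [A UA]] := @V_not_far x (e / 2); first by rewrite divr_gt0.
have FUA : F [set g | exists2 y, y \in A & mdist x (g y) < e / 2].
  by apply: VF; apply: filterS VU => g; exact: UA.
have FUA' : F [set g : Iso M | exists2 y, y \in A & mdist x ((g^-1)%g y) < e /
  2].
  apply: VF; have : V [set g | U (g^-1)%g] by apply: (@tnbhs_inv 1%g U);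
    rewrite invg1.
  by apply: filterS => g /UA.
have [y yA Fy] := ultra_seq_pigeonhole FU FUA.
have [z zA Fz] := ultra_seq_pigeonhole FU FUA'.
exists ([set g : Iso M | mdist x (g y) < e / 2] `&`
    [set g : Iso M | mdist x ((g^-1)%g z) < e / 2]); first exact: filterI.
move=> f g [/= fy fz] [/= gy gz]; split.
  have := metric_triangle (f x) z (g x).
  move: fz gz; rewrite !(metric_sym x) !mdist_IsoV (metric_sym z (g x))
    (metric_sym z (f x)); lra.
have := metric_triangle ((f^-1)%g x) y ((g^-1)%g x).
rewrite (metric_sym y) !mdist_IsoV; lra.
Qed.

Let V_point x e : 0 < e -> V [set g : Iso M | mdist x (g x) < e].
Proof.
move=> e0; pose S := [set g : Iso M | mdist x (g x) < e].
apply: contrapT => nV.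
(* An ultrafilter refining this trace converges to some [f]. It also converges to 1 for [t], so
   [f = 1] and it contains [S], a contradiction. *)
have FP : ProperFilter (within (~` S) V).
  split; last exact: within_filter.
  by move=> V0; apply: nV; apply: (@filterS _ V _ _ _ _ V0) => g nS;
    exact: contrapT.
have [F [FU VF]] := ultraFilterLemma FP.
have VF' : V `<=` F by move=> U VU; apply: VF;
  apply: (@filterS _ V _ _ _ _ VU) => g.
have [f Ff] := ultra_cvg FU VF'.
have f1 : f = 1%g.
  apply: t_hausdorff => A B /tnbhs_nbhs/Ff FA /VF' FB.
  exact: (filter_ex (filterI FA FB)).
have FS : F S.
  apply: Ff; rewrite f1; apply/nbhs_Iso; exists [:: x], e => // g.
  by move=> /(_ x (mem_head _ _)).
have FS' : F (~` S) by apply: VF; rewrite /within /=; apply: (@filterE _ V).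
by have [g []] := filter_ex (filterI FS FS').
Qed.

Lemma coarser_topology_eq : @open (Topological.Pack t) = @open (Iso M).
Proof.
have V1 U : nbhs (1 : Iso M)%g U -> V U.
  move=> /nbhs_Iso[A [e e0 AU]]; apply: (@filterS _ V _ _ _ AU) => {AU}.
  elim: A => [|x A IH]; first by apply: (@filterE _ V) => g y.
  apply: (@filterS _ V _ _ _ _ (@filterI _ V _ _ _ (V_point x e0) IH)) => g
    [/= gx gA] y.
  by rewrite inE => /predU1P[->|/gA].
apply/seteqP; split=> // O; rewrite !openE => oO g Og.
have : V [set a | O (g * a)%g].
  apply: V1; apply/nbhs_Iso.
  have /nbhs_Iso[A [e e0 AO]] := oO g Og; exists A, e => // a aA.
  by apply: AO => x xA; rewrite IsoE mdist_Iso; exact: aA.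
move=> VO.
have : tnbhs g [set a | O (g * (g^-1 * a))%g].
  by apply: (@tnbhs_mull (g^-1)%g g [set a | O (g * a)%g]); rewrite mulVg.
by apply: (@filterS _ (tnbhs g)) => a /=; rewrite mulgA mulgV mul1g.
Qed.

End coarser_topology.

Lemma Iso_minimal : minimal_group (Iso M).
Proof.
by split=> [|t tg th tc]; [exact: Iso_hausdorff|exact: coarser_topology_eq].
Qed.

End simple_and_minimal.

(** * Infinite cardinals *)

Section cardinals.
Local Open Scope card_scope.

Lemma card_le_inj T U (A : set T) (B : set U) (f : T -> U) :
  (forall x, A x -> B (f x)) ->
  (forall x y, A x -> A y -> f x = f y -> x = y) -> A #<= B.
Proof.
move=> AB finj.
have [g] : $|{injfun A >-> B}|.
  apply/injfunPex; exists f => // x y; rewrite !inE; exact: finj.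
exact: inj_card_le g.
Qed.

(* A maximal set of choice functions which is injective in each coordinate has
   a surjective coordinate, which is then the least cardinal. *)
Lemma least_card (T : Type) (F : set (set T)) : F !=set0 ->
  exists2 A, F A & forall B, F B -> A #<= B.
Proof.
move=> [A0 FA0].
pose P (Y : set (set T -> T)) := forall A, F A ->
  (forall s, Y s -> A (s A)) /\ (forall s s', Y s -> Y s' -> s A = s' A -> s =
    s').
have [|Y [PY Ymax]] := @Zorn_bigcup _ P.
  move=> C CP Ctot A FA; split=> [s [Y CY Ys]|s s' [Y CY Ys] [Y' CY' Ys']].
    exact: ((CP _ CY A FA).1 s Ys).
  have [YY|YY] := Ctot _ _ CY CY'.
    by apply: ((CP _ CY' A FA).2) => //; exact: YY.
  by apply: ((CP _ CY A FA).2) => //; exact: YY.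
have [[A FA Asurj]|Ansurj] := pselect (exists2 A, F A &
    forall u, A u -> exists2 s, Y s & s A = u).
  exists A => // B FB.
  have /choice[t tP] u : exists s, A u -> Y s /\ s A = u.
    have [/Asurj[s Ys sA]|nAu] := pselect (A u); first by exists s.
    by exists (fun=> u).
  apply: (@card_le_inj _ _ _ _ (fun u => t u B)) => [u /tP[Ytu _]|u v Au Av
    tuv].
    exact: ((PY B FB).1 _ Ytu).
  have [Yu <-] := tP u Au; have [Yv <-] := tP v Av.
  by congr (_ A); apply: ((PY B FB).2).
have missed A : F A -> exists u, A u /\ forall s, Y s -> s A <> u.
  move=> FA; apply: contrapT => nu; apply: Ansurj; exists A => // u Au.
  apply: contrapT => ns; apply: nu; exists u; split=> // s Ys sA.
  by apply: ns; exists s.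
have [u0 _] := missed A0 FA0.
(* If no coordinate is surjective, the choice function [s] takes in each coordinate a value missed
   by [Y], and can be added to [Y]. *)
have /choice[s sP] A : exists u, F A -> A u /\ forall s', Y s' -> s' A <> u.
  by have [/missed[u uP]|nFA] := pselect (F A); [exists u|exists u0].
exfalso; apply: (Ymax (Y `|` [set s])).
  split=> [s' Ys'|sub]; first by left.
  have [_ /(_ s)] := sP A0 FA0; apply => //.
  by apply: sub; right.
move=> A FA; have [As sY] := sP A FA; split=> [s' [|->//]|].
  exact: ((PY A FA).1).
move=> s1 s2 [Y1|->] [Y2|->] //.
- exact: ((PY A FA).2).
- by move=> /(sY _ Y1).
- by move=> /esym/(sY _ Y2).
Qed.

Lemma card_le_total T (A B : set T) : A #<= B \/ B #<= A.
Proof.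
have [|C + CAB] := @least_card T [set A; B]; first by exists A; left.
by case=> CE; rewrite CE in CAB; [left; apply: CAB; right|right; apply: CAB;
  left].
Qed.

Lemma card_le_fun T (A B : set T) : A #<= B ->
  exists2 f : T -> T, forall x, A x -> B (f x) &
    forall x y, A x -> A y -> f x = f y -> x = y.
Proof.
elim/Ppointed: T A B => T A B.
  by move=> _; exists id => // x; rewrite emptyE.
move=> /pcard_leP/injfunPex[f fAB finj]; exists f => // x y Ax Ay.
by apply: finj; rewrite inE.
Qed.

(** * An infinite type contains its own square, and its finite sequences *)

Section pairing.
Variables (T : Type) (h : nat -> T).
Hypothesis h_inj : injective h.

Let dom (G : set (T * T * T)) x := exists z, G (x, x, z).

(* [G] is the graph of an injection of [A * A] into [A] for [A := dom G]. *)
Let pairing_graph (G : set (T * T * T)) := [/\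
  forall x y z z', G (x, y, z) -> G (x, y, z') -> z = z',
  forall x y x' y' z, G (x, y, z) -> G (x', y', z) -> x = x' /\ y = y',
  forall x y z, G (x, y, z) -> [/\ dom G x, dom G y & dom G z] &
  forall x y, dom G x -> dom G y -> exists z, G (x, y, z)].

Let G0 : set (T * T * T) := [set p | exists i j, p = (h i, h j, h (pickle (i,
  j)))].

Let pairing_G0 : pairing_graph G0.
Proof.
split.
- by move=> x y z z' [i [j [-> -> ->]]] [i' [j' [/h_inj-> /h_inj-> ->]]].
- move=> x y x' y' z [i [j [-> -> ->]]] [i' [j' [-> ->]]] /h_inj.
  by move=> /(pcan_inj pickleK)[-> ->].
- move=> x y z [i [j [-> -> ->]]]; split; by [exists (h (pickle (i, i))), i, i|
    exists (h (pickle (j, j))), j, j|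
    exists (h (pickle (pickle (i, j), pickle (i, j)))), (pickle (i, j)),
      (pickle (i, j))].
- move=> x y [z [i [_ [-> _ _]]]] [z' [j [_ [-> _ _]]]].
  by exists (h (pickle (i, j))), i, j.
Qed.

Let maximal_pairing_graph : exists G, [/\ pairing_graph G, G0 `<=` G &
  forall H, pairing_graph H -> G `<=` H -> H `<=` G].
Proof.
(* Adjoining [G0] to every [X] makes the empty chain harmless and keeps the maximal graph
   infinite. *)
have [|X [PX Xmax]] := @Zorn_bigcup _ [set X | pairing_graph (G0 `|` X)].
  move=> C CP Ctot /=; set G := G0 `|` _.
  have common p q : G p -> G q -> exists H, [/\ pairing_graph H, H `<=` G, H p
    & H q].
    have sub X : C X -> G0 `|` X `<=` G.
      by move=> CX r [G0r|Xr]; [left|right; exists X].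
    move=> [Gp|[X CX Xp]] [Gq|[Y CY Yq]].
    - by exists G0; split=> // r; left.
    - by exists (G0 `|` Y); split; [exact: CP|exact: sub|left|right].
    - by exists (G0 `|` X); split; [exact: CP|exact: sub|right|left].
    - have [XY|YX] := Ctot _ _ CX CY.
        by exists (G0 `|` Y); split; [exact: CP|exact: sub|right;
          exact: XY|right].
      by exists (G0 `|` X); split; [exact: CP|exact: sub|right|right;
        exact: YX].
  have dom_sub H x : H `<=` G -> dom H x -> dom G x by move=> HG [z /HG];
    exists z.
  split.
  - move=> x y z z' p q; have [H [[HF _ _ _] _]] := common _ _ p q; exact: HF.
  - move=> x y x' y' z p q; have [H [[_ HI _ _] _]] := common _ _ p q;
      exact: HI.
  - move=> x y z p; have [H [[_ _ HD _] HG /HD[? ? ?] _]] := common _ _ p p.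
    by split; exact: dom_sub HG _.
  - move=> x y [z p] [z' q]; have [H [[_ _ _ HT] HG Hp Hq]] := common _ _ p q.
    have [||w Hw] := HT x y; [by exists z|by exists z'|].
    by exists w; exact: HG.
exists (G0 `|` X); split=> // H PH XH.
apply: contrapT => HX; apply: (Xmax H).
  split=> [p Xp|HX']; first by apply: XH; right.
  by apply: HX => p /HX'; right.
by rewrite /= (setUidr _) // => p G0p; apply: XH; left.
Qed.

Lemma infinite_pairing : exists f : T -> T -> T,
  forall x y x' y', f x y = f x' y' -> x = x' /\ y = y'.
Proof.
have [G [[GF GI GD GT] G0G Gmax]] := maximal_pairing_graph.
pose A := dom G.
have Ah i : A (h i) by exists (h (pickle (i, i))); apply: G0G; exists i, i.
have [f fP] : exists f : T -> T -> T, forall x y, A x -> A y -> G (x, y, f x y).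
  have /choice[f fP] (p : T * T) : exists z, A p.1 -> A p.2 -> G (p, z).
    case: p => x y /=; have [[Ax Ay]|nA] := pselect (A x /\ A y);
      last by exists (h 0) => ? ?; case: nA.
    by have [z Gz] := GT x y Ax Ay; exists z.
  by exists (fun x y => f (x, y)) => x y Ax Ay; exact: (fP (x, y)).
have fA x y : A x -> A y -> A (f x y) by move=> Ax Ay;
  have [] := GD _ _ _ (fP x y Ax Ay).
have finj x y x' y' : A x -> A y -> A x' -> A y' -> f x y = f x' y' -> x = x'
  /\ y = y'.
  move=> Ax Ay Ax' Ay' fE; apply: GI (fP x y Ax Ay) _.
  by rewrite fE; exact: fP.
have hN i j : i != j -> h i <> h j by move=> /eqP ij /h_inj.
have [/card_le_fun[k kA kinj]|/card_le_fun[k kA kinj]] := card_le_total (~` A)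
  A.
  (* When [~A] injects into [A], so does the whole type: [h 0] and [h 1] tag the two parts. *)
  pose i x := if `[< A x >] then f (h 0) x else f (h 1) (k x).
  have iA x : A (i x) by rewrite /i; case: asboolP => Ax; apply: fA => //;
    exact: kA.
  have i_inj x y : i x = i y -> x = y.
    rewrite /i; case: asboolP => Ax; case: asboolP => Ay /finj[] //;
      try exact: kA.
    - by move=> /(hN 0 1 isT).
    - by move=> /(hN 1 0 isT).
    - by move=> _ /kinj; apply.
  exists (fun x y => f (i x) (i y)) => x y x' y' /finj[] // /i_inj-> /i_inj->.
  by [].
exfalso.
pose e (b : bool) x := if b then k x else x.
have e_inj b b' x x' : A x -> A x' -> e b x = e b' x' -> b = b' /\ x = x'.
  move=> Ax Ax'; case: b b' => -[] //=.
  - by move=> /kinj-> .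
  - by move=> E; case: (kA x Ax); rewrite E.
  - by move=> E; case: (kA x' Ax'); rewrite -E.
(* When [A] injects into [~A], the graph is extended to two copies of [A]. The three new blocks of
   pairs all take values in the new copy and are told apart by the tags [h 1], [h 2], [h 3]; the old
   block keeps [f]. *)
pose g (b b' : bool) x y := if b || b' then f (h (b.*2 + b')) (f x y) else f x
  y.
have gA b b' x y : A x -> A y -> A (g b b' x y).
  by move=> Ax Ay; rewrite /g; case: ifP => _; last exact: fA;
    apply: (fA) => //; exact: fA.
have g_inj b b' c c' x y x' y' : A x -> A y -> A x' -> A y' ->
    b || b' = c || c' -> g b b' x y = g c c' x' y' ->
    [/\ b = c, b' = c', x = x' & y = y'].
  move=> Ax Ay Ax' Ay' bc; rewrite /g -bc; case: ifP bc => bb bc; last first.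
    move=> /finj[] // -> ->.
    by move: bb bc; clear; case: b; case: b'; case: c; case: c'.
  move=> /finj[]; try exact: fA; try exact: Ah.
  move=> /h_inj + /finj[] // -> ->.
  by move: bb bc; clear; case: b; case: b'; case: c; case: c'.
pose H : set (T * T * T) := [set p | exists b b' x y, [/\ A x, A y &
  p = (e b x, e b' y, e (b || b') (g b b' x y))]].
have eH b x : A x -> dom H (e b x).
  by move=> Ax; exists (e (b || b) (g b b x x)), b, b, x, x.
have HP : pairing_graph H.
  split.
  - move=> x y z z' [b [b' [u [v [Au Av [-> -> ->]]]]]].
    move=> [c [c' [u' [v' [Au' Av' [/e_inj E /e_inj E' ->]]]]]].
    by have [-> ->] := E Au Au'; have [-> ->] := E' Av Av'.
  - move=> x y x' y' z [b [b' [u [v [Au Av [-> -> ->]]]]]].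
    move=> [c [c' [u' [v' [Au' Av' [-> ->]]]]]] /e_inj[]; try exact: gA;
      move=> bc.
    by move=> /g_inj[] // -> -> -> ->.
  - move=> x y z [b [b' [u [v [Au Av [-> -> ->]]]]]].
    by split; apply: eH => //; exact: gA.
  - move=> x y [z [b [_ [u [_ [Au _ [-> _ _]]]]]]] [z' [b' [_ [v [_ [Av _ [->
      _ _]]]]]]].
    by exists (e (b || b') (g b b' u v)), b, b', u, v.
have GH : G `<=` H.
  move=> [[x y] z] Gxyz; have [Ax Ay _] := GD _ _ _ Gxyz.
  exists false, false, x, y; split=> //=.
  by rewrite /g /= (GF _ _ _ _ Gxyz (fP x y Ax Ay)).
have [z kH] := eH true (h 0) (Ah 0).
by apply: (kA _ (Ah 0)); exists z; exact: Gmax kH.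
Qed.

(** Iterated pairing alone may confuse sequences of different lengths, so the length is recorded
    first. *)
Lemma infinite_seq_inj : exists f : seq T -> T, injective f.
Proof.
have [f finj] := infinite_pairing.
pose code := foldr f (h 0).
exists (fun s => f (h (size s)) (code s)) => s t /finj[/h_inj].
elim: s t => [|x s IH] [|y t] //= [st] /finj[-> E].
by rewrite (IH _ st E).
Qed.

End pairing.

End cardinals.

(** * Weight *)

Section weight.
Variables (R : realType) (M : metricType R).
Hypotheses (M_Urysohn : Urysohn_space M) (M_homogeneous : omega_homogeneous M).
Local Open Scope card_scope.

Lemma nbhs_mdist_ex (x : M) (U : set M) : nbhs x U ->
  exists2 e, 0 < e & forall y, mdist x y < e -> U y.
Proof.
by move=> /metricType_numDomainType.nbhs_mdistP[e e0 eU]; exists e.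
Qed.

Lemma nbhs_mdist_lt (x : M) e : 0 < e -> nbhs x [set y | mdist x y < e].
Proof. by move=> e0; apply/metricType_numDomainType.nbhs_mdistP; exists e. Qed.

Lemma open_nbhsP (T : topologicalType) (U : set T) :
  open U <-> forall x, U x -> nbhs x U.
Proof. by rewrite openE. Qed.

(** For [y] near [f x], gluing gives [w] sending [f x] exactly to [y] and moving each [f a] by at
    most [mdist (f x) y]; then [w * f] is in [U]. *)
Lemma orbit_map_open (x : M) (f : Iso M) (U : set (Iso M)) : nbhs f U ->
  nbhs (f x) [set g x | g in U].
Proof.
move=> /nbhs_Iso[A [e e0 AU]];
  apply: filterS (nbhs_mdist_lt (f x) e0) => y /= fxy.
have [|w wP] := @glue_isometry_le _ _ M_Urysohn
    ((f x, y, 0) :: [seq (f a, f a, mdist (f x) y) | a <- A]) _ M_homogeneous.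
  move=> p q; rewrite !inE => /predU1P[->|/mapP[a _ ->]] /predU1P[->|/mapP[b _
    ->]] /=.
  - by rewrite !mdistxx subrr normr0 addr0.
  - rewrite add0r ler_distl; apply/andP; split.
      have := metric_triangle y (f x) (f b); rewrite (metric_sym y (f x)); lra.
    have := metric_triangle (f x) y (f b); lra.
  - rewrite addr0 ler_distl; apply/andP; split.
      have := metric_triangle (f a) (f x) y; lra.
    have := metric_triangle (f a) y (f x); rewrite (metric_sym y (f x)); lra.
  - by rewrite subrr normr0 addr_ge0 ?mdist_ge0.
exists (w * f)%g.
  apply: AU => a aA; rewrite IsoE metric_sym; apply: le_lt_trans fxy.
  apply: (wP (f a, f a, mdist (f x) y)).
  by rewrite inE (map_f (fun a => (f a, f a, mdist (f x) y))) ?orbT.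
apply: mdist_positivity; apply/eqP; rewrite eq_le mdist_ge0 andbT IsoE.
exact: (wP (f x, y, 0) (mem_head _ _)).
Qed.

Lemma orbit_map_basis (B : set (set (Iso M))) (x : M) : basis B ->
  basis [set [set g x | g in U] | U in B].
Proof.
move=> [Bo Bn]; split=> [_ [U BU <-]|y N nN].
  apply/open_nbhsP => _ [g Ug <-]; apply: orbit_map_open.
  exact: (open_nbhsP U).1 (Bo _ BU) _ Ug.
have [f fx] := Iso_transitive M_Urysohn M_homogeneous x y.
have [e e0 eN] := nbhs_mdist_ex nN.
have [U [BU Uf] UN] := Bn f _ (nbhs_Iso_ball f [:: x] e0).
exists [set g x | g in U] => /=; first by split; [exists U|exists f].
by move=> _ [g /UN gf <-]; apply: eN; rewrite -fx; exact: gf (mem_head _ _).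
Qed.

Section basis_of_Iso.
Variable C : set (set M).
Hypothesis C_basis : basis C.

Lemma basis_ball (x : M) e : 0 < e ->
  exists U : C, val U x /\ forall y, val U y -> mdist x y < e.
Proof.
move=> e0; have [U [CU Ux] Ue] := C_basis.2 x _ (nbhs_mdist_lt x e0).
by exists (SigSub (mem_set CU)).
Qed.

Lemma basis_open (U : C) : open (val U).
Proof. exact/C_basis.1/set_mem/valP. Qed.

(** Choose a point in each member of a finite base. Some [y] is at distance 1 from all of them, so
    no member around [y] fits in its open unit ball. *)
Lemma basis_infinite : infinite_set C.
Proof.
have [x0 _] := Urysohn_inhabited M_Urysohn.
move=> /(finite_image (xget x0))/finite_seqP[D CD].
have [||y yD] := @one_point_extension _ _ M_Urysohn [seq (x, 1) | x <- D].
- by move=> _ /mapP[x _ ->].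
- move=> _ _ /mapP[x _ ->] /mapP[x' _ ->] /=; rewrite lerDl mdist_ge0;
    split=> //.
  by rewrite (le_trans (Urysohn_dist_le1 M_Urysohn _ _)) // lerDl ler01.
have [U [Uy Ue]] := basis_ball y ltr01.
have Ux : val U (xget x0 (val U)) by apply: xgetPex; exists y.
have /(map_f (fun x => (x, 1 : R))) : xget x0 (val U) \in D.
  suff : [set` D] (xget x0 (val U)) by [].
  by rewrite -CD; exists (val U) => //; exact/set_mem/valP.
move=> xP; have := Ue _ Ux; rewrite metric_sym (yD _ xP) /=.
by rewrite ltxx.
Qed.

Variable x0 : M.

(** The chosen points of the members of [C] serve as a dense set; [x0] is the choice for an empty
    member. *)
Definition Iso_cylinder (s : seq (C * C)) : set (Iso M) :=
  foldr (fun p U => [set g | val p.2 (g (xget x0 (val p.1)))] `&` U) setT s.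

Lemma Iso_cylinder_open s : open (Iso_cylinder s).
Proof.
elim: s => [|p s IH]; first exact: openT.
apply: openI IH; apply/open_nbhsP => g /= pg.
have [e e0 ep] := nbhs_mdist_ex ((open_nbhsP _).1 (basis_open p.2) _ pg).
apply/nbhs_Iso; exists [:: xget x0 (val p.1)], e => // h hg.
exact: ep (hg _ (mem_head _ _)).
Qed.

Lemma Iso_cylinder_basis : basis (range Iso_cylinder).
Proof.
split=> [_ [s _ <-]|f N /nbhs_Iso[A [e e0 AN]]]; first exact: Iso_cylinder_open.
suff [s sf sA] : exists2 s, Iso_cylinder s f & Iso_cylinder s `<=` Iso_ball f
  A e.
  exists (Iso_cylinder s) => /=; first by split=> //; exists s.
  by apply: subset_trans AN.
elim: A {AN} => [|x A [s sf sA]]; first by exists [::].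
(* Going from [f x] to [g x] through [f p] and [g p] takes three steps, each below [e / 4]. *)
have e4 : 0 < e / 4 by rewrite divr_gt0.
have [U [Ux Ue]] := basis_ball x e4.
have Up : val U (xget x0 (val U)) by apply: xgetPex; exists x.
have [W [Wf We]] := basis_ball (f (xget x0 (val U))) e4.
exists ((U, W) :: s); first by split.
move=> g [/= /We gp /sA gA] y; rewrite inE => /predU1P[->|]; last exact: gA.
have := Ue _ Up; move: gp; set p := xget _ _ => gp xp.
have := metric_triangle (f x) (f p) (g x).
have := metric_triangle (f p) (g p) (g x).
rewrite !mdist_Iso (metric_sym p); lra.
Qed.

Lemma card_Iso_cylinder : range Iso_cylinder #<= C.
Proof.
have /infiniteP/card_leP[k] := basis_infinite.
have h_inj : injective (fun n => k (SigSub (mem_set (I : [set: nat] n)))).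
  by move=> m n /(@inj _ _ _ k); rewrite !inE => /(_ I I)[].
have [f f_inj] := infinite_seq_inj h_inj;
  have [p p_inj] := infinite_pairing h_inj.
apply: card_le_trans (card_image_le _ _) _.
apply: (@card_le_inj _ _ _ _ (fun s => val (f (map (fun q => p q.1 q.2) s)))).
  by move=> s _; exact/set_mem/valP.
move=> s t _ _ /val_inj/f_inj; apply: inj_map => -[a b] [c d] /p_inj[/= -> ->].
by [].
Qed.

End basis_of_Iso.

(** For a base [C] of least cardinality, the cylinders number at most [C]. Conversely the orbit map
    at [x0] turns any base of [Iso M] into a base of [M] that is no larger, so [C] bounds it from
    below. *)
Lemma Iso_same_weight : same_weight (Iso M) M.
Proof.
have [x0 _] := Urysohn_inhabited M_Urysohn.
have [|C C_basis C_min] := @least_card (set M) (@basis M).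
  exists open; split=> // x N; rewrite nbhsE => -[U [oU Ux] UN].
  by exists U.
have B_min (B' : set (set (Iso M))) : basis B' -> C #<= B'.
  move=> B'_basis; have /C_min CB := orbit_map_basis x0 B'_basis;
    apply: card_le_trans CB _.
  exact: card_image_le.
have BC := card_Iso_cylinder C_basis x0.
have B_basis := Iso_cylinder_basis C_basis x0.
exists (range (@Iso_cylinder C x0)), C; split=> //.
- by split=> // B' /B_min; exact: card_le_trans.
- by apply/Cantor_Bernstein => //; exact: B_min.
Qed.

End weight.

Theorem theorem1p8 (R : realType) (M : metricType R)
    (M_complete : complete_space M) (M_homogeneous : omega_homogeneous M)
    (M_Urysohn : Urysohn_space M) :
  [/\ complete_group (Iso M), Roelcke_precompact (Iso M),
      minimal_group (Iso M), topologically_simple (Iso M) &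
      same_weight (Iso M) M].
Proof.
split.
- exact: Iso_complete.
- exact: Iso_Roelcke_precompact.
- exact: Iso_minimal.
- exact: Iso_topologically_simple.
- exact: Iso_same_weight.
Qed.
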